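(* If the family $\mathbb K=(K_n)_n\in\mathcal K_\Xi$ is $(M)$-singular (resp. $(U)$-singular), then there exists $\alpha\in\mathbb R^+$ such that, for every $f\in\mathcal C_c(G)$, the sequence $\varphi(\alpha|T_nf-f|)$, $n\in\mathbb N$, converges to $0$ in $\mu$-measure (resp. uniformly) on every set $A\in\mathcal A$ with $\mu(A)<+\infty$. Moreover, for every $f\in\mathcal C_c(G)$ the sequence $(T_nf)_n$ converges to $f$ in $\mu$-measure (resp. uniformly) on each set $A\in\mathcal A$ such that $\mu(A)<+\infty$.
   Context: Conventions. All vector lattices are Dedekind complete. For such a lattice $Y$: $Y^+=\{y\in Y:y\ge 0\}$, $|y|=y\vee(-y)$, $\overline Y^+=Y^+\cup\{+\infty\}$ with order and operations extended in the natural way and $0\cdot(+\infty)=0$. $\mathbb R^+=(0,\infty)$, $\mathbb R_0^+=[0,\infty)$. An $(o)$-sequence in $Y$ is a decreasing sequence in $Y^+$ with infimum $0$. ''Definitely'' means for all but finitely many $n$. The supremum of an empty family of positive elements is $0$. Convergences. A convergence on $Y$ is a pair $(\mathcal S,\ell)$, where $\mathcal S$ is a linear subspace of the space of all sequences in $Y$ and $\ell:\mathcal S\to Y$ satisfies: (a) $\ell$ is linear; (b) if $(x_n),(y_n)\in\mathcal S$ and $x_n\le y_n$ definitely, then $\ell((x_n))\le\ell((y_n))$; (c) if $x_n=c$ definitely then $(x_n)\in\mathcal S$ and $\ell((x_n))=c$; if $(x_n)\in\mathcal S$ and $x_n\ne y_n$ for only finitely many $n$, then $(y_n)\in\mathcal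 S$ and $\ell((y_n))=\ell((x_n))$; (d) if $(x_n)\in\mathcal S$ then $(|x_n|)\in\mathcal S$ and $\ell((|x_n|))=|\ell((x_n))|$; (e) if $(x_n),(z_n)\in\mathcal S$, $\ell((x_n))=\ell((z_n))$ and $x_n\le y_n\le z_n$ definitely, then $(y_n)\in\mathcal S$; (f) for $u\in Y^+$, $(\frac1n u)_n\in\mathcal S$ and $\ell((\frac1n u)_n)=0$. Writing $\ell((x_n)_n)=c$ means that $(x_n)_n$ is a sequence in $Y$ belonging to $\mathcal S$ and that the value of $\ell$ is $c$. Limit superior. Each convergence $(\mathcal S,\ell)$ comes with a map $\overline\ell$ from the set of sequences in $Y^+$ to $\overline Y^+$ such that: (a) $\overline\ell((x_n))=\overline\ell((y_n))$ if $x_n=y_n$ definitely; (b) $\overline\ell((x_n+y_n))\le\overline\ell((x_n))+\overline\ell((y_n))$; (c) if $x_n\le y_n$ definitely then $\overline\ell((x_n))\le\overline\ell((y_n))$; (d) $\overline\ell((x_n))=\ell((x_n))$ if $(x_n)\in\mathcal S$; (e) if $\overline\ell((x_n))=0$ then $(x_n)\in\mathcal S$ and $\ell((x_n))=0$. Product triples. $(Y_1,Y_2,Y)$, with convergences $\ell_1,\ell_2,\ell$ (and $\overline\ell_1,\overline\ell_2,\overline\ell$), is a product triple if there is a map $\cdot:Y_1\times Y_2\to Y$ with: (1),(2) additivity in each variable; (3) $x_1\ge y_1$ and $x_2\ge0$ imply $x_1\cdot x_2\ge y_1\cdot x_2$; (4) $x_1\ge0$ and $x_2\ge y_2$ imply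 $x_1\cdot x_2\ge x_1\cdot y_2$; (5) if $(x_n)$ is an $(o)$-sequence in $Y_1$ and $y\in Y_2^+$, then $(x_n\cdot y)$ is an $(o)$-sequence; (6) if $x\in Y_1^+$ and $(y_n)$ is an $(o)$-sequence in $Y_2$, then $(x\cdot y_n)$ is an $(o)$-sequence; (7) $\ell_1((x_n))=0$, $y\in Y_2$ imply $\ell((x_n\cdot y))=0$; (8) $x\in Y_1$, $\ell_2((y_n))=0$ imply $\ell((x\cdot y_n))=0$; (9) $x_n\in Y_1^+$, $\overline\ell_1((x_n))=x$, $y\in Y_2^+$ imply $\overline\ell((x_n\cdot y))=x\cdot y$; (10) $x\in Y_1^+$, $y_n\in Y_2^+$, $\overline\ell_2((y_n))=y$ imply $\overline\ell((x\cdot y_n))=x\cdot y$. $Y$ is a product algebra if $(Y,Y,Y)$ is a product triple. Setting. $\mathbf X$ is a product algebra with convergence $\ell$, $\mathbb R$ carries a convergence $\ell_{\mathbb R}$ (with $\overline\ell_{\mathbb R}$), $(\mathbb R,\mathbf X,\mathbf X)$ and $(\mathbf X,\mathbb R,\mathbf X)$ are product triples; products of reals with elements of $\mathbf X$ are scalar multiplication. $(G,d)$ is a metric space, $\mathcal A$ its Borel $\sigma$-algebra, $\mu:\mathcal A\to[0,+\infty]$ a $\sigma$-finite regular measure: $\mu(C)<+\infty$ for every compact $C\subset G$, and for every $\varepsilon>0$ and $E\in\mathcal A$ there are a compact $C\subset E$ and an open $U\supset E$ with $\mu(U\setminus C)\le\varepsilon$. Condition H*. For $e\in\mathbf X^+\setminus\{0\}$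 let $V[e]=\{x\in\mathbf X:\exists\delta>0,\ |x|\le\delta e\}$ and $\|x\|_e=\inf\{\varepsilon>0:|x|\le\varepsilon e\}$. It is assumed that if $(x_n)_n$ is a sequence in $V[e]$ with $\ell_{\mathbb R}((\|x_n\|_e)_n)=0$, then $\ell((|x_n|)_n)=0$. Integral (for $Y$-valued functions on $G$, where $Y=\mathbf X$, $\ell_Y=\ell$, or $Y=\mathbb R$, $\ell_Y=\ell_{\mathbb R}$). $f:G\to Y$ is simple if $f=\sum_{j=1}^rc_j\chi_{A_j}$ with $c_j\in Y$, $A_j\in\mathcal A$, $\mu(A_j)<+\infty$; $\int_Af\,d\mu=\sum_jc_j\,\mu(A\cap A_j)$. $(f_n)_n$ converges in $\mu$-measure to $f$ on $A\in\mathcal A$ if there are $A_n\in\mathcal A$ with $\ell_{\mathbb R}((\mu(A\cap A_n))_n)=0$ and $\ell_Y\big(\big(\bigvee_{g\in A\setminus A_n}|f_n(g)-f(g)|\big)_n\big)=0$; it converges uniformly to $f$ on $A$ if $\ell_Y\big(\big(\bigvee_{g\in A}|f_n(g)-f(g)|\big)_n\big)=0$. The integrals of simple $f_n$ are $\mu$-equiabsolutely continuous if (i) $\ell_Y((\int_{A_n}|f_n|\,d\mu)_n)=0$ whenever $A_n\in\mathcal A$, $\ell_{\mathbb R}((\mu(A_n))_n)=0$; (ii) there is an increasing sequence $(B_m)_m$ in $\mathcal A$ of sets of finite measure with $\ell_Y\big(\big(\overline\ell_Y((\int_{G\setminus B_m}|f_n|\,d\mu)_n)\big)_m\big)=0$.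 A sequence of simple functions is defining for $f$ if it converges in $\mu$-measure to $f$ on every $A\in\mathcal A$ of finite measure and has $\mu$-equiabsolutely continuous integrals. A positive $f$ is integrable if there are a defining sequence $(f_n)_n$ and $l:\mathcal A\to Y$ with $\ell_Y\big(\big(\bigvee_{A\in\mathcal A}|\int_Af_n\,d\mu-l(A)|\big)_n\big)=0$; then $\int_Af\,d\mu:=l(A)$ (independent of choices). A general $f$ is integrable if $f^\pm$ are, with $\int_Af\,d\mu=\int_Af^+\,d\mu-\int_Af^-\,d\mu$. Uniform continuity, $\mathcal C_c(G)$, convexity. $f:G\to\mathbf X$ is uniformly continuous if there is $u\in\mathbf X^+$ such that for each $\varepsilon>0$ there is $\delta>0$ with $|f(g_1)-f(g_2)|\le\varepsilon u$ whenever $d(g_1,g_2)\le\delta$. $\mathcal C_c(G)$ is the space of uniformly continuous $f:G\to\mathbf X$ with compact support. A map $\psi$ defined on $\mathbf X^+$ with values in $\mathbf X$ is uniformly continuous if for every $u\in\mathbf X^+$, $\varepsilon>0$ there are $w\in\mathbf X^+$, $\delta>0$ with $|\psi(x_1)-\psi(x_2)|\le\varepsilon w$ whenever $|x_1-x_2|\le\delta u$. $\varphi:\mathbf X\to\mathbf X$ is convex if for each $v\in\mathbf X$ there is $\beta_v\in\mathbf X$ with $\varphi(s)\ge\varphi(v)+\beta_v\cdot(s-v)$ for all $s$, and $\{\beta_v:-u\le v\le u\}$ is order bounded for every $u\in\mathbf X^+\setminus\{0\}$. Kernels and operators. $\mathcal M$ is the class of functions $L:G\times G\to\mathbb R_0^+$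 measurable for the product $\sigma$-algebra whose sections $L(\cdot,t)$, $L(s,\cdot)$ are integrable and bounded on every set of finite measure. $\Psi$ is the family of uniformly continuous increasing $\psi:\mathbf X^+\to\mathbf X^+$ with $\psi(0)=0$ and $\psi(v)\in\mathbf X^+\setminus\{0\}$ for $v\in\mathbf X^+\setminus\{0\}$. $\Xi=(\psi_n)_n\subset\Psi$ is a sequence such that: for every $u\in\mathbf X^+\setminus\{0\}$, $\varepsilon>0$ there are $w\in\mathbf X^+\setminus\{0\}$, $\delta>0$ with $\psi_n(x)\le\varepsilon w$ for all $n$ and all $x\in\mathbf X^+$ with $x\le\delta u$; and for every $v\in\mathbf X^+$ there is $A_v\in\mathbf X^+\setminus\{0\}$ with $\psi_n(v)\le A_v$ for all $n$. $\mathcal K_\Xi$ is the class of sequences $K_n:G\times G\times\mathbf X\to\mathbf X$ such that $K_n(\cdot,t,u)$, $K_n(s,\cdot,u)$ are integrable for all $s,t\in G$, $u\in\mathbf X$, $n$; $K_n(s,t,0)=0$; and there is $(L_n)_n\subset\mathcal M$ with (Lip) $|K_n(s,t,u)-K_n(s,t,v)|\le L_n(s,t)\,\psi_n(|u-v|)$ for all $n,s,t,u,v$. $\varphi:\mathbf X\to\mathbf X$ is convex, increasing on $\mathbf X^+$, $\varphi(0)=0$, $\varphi(x)\in\mathbf X^+\setminus\{0\}$ for $x\in\mathbf X^+\setminus\{0\}$. The operators are $(T_nf)(s)=\int_GK_n(s,t,f(t))\,d\mu(t)$, $s\in G$, for $f$ in the common domain $\bigcap_n\mathrm{Dom}\,T_n$,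 $\mathrm{Dom}\,T_n$ being the set of $f$ on which $T_nf$ is well-defined; whenever $T_nf$ is written, it is understood that $f$ lies in this domain. Singularity. For infinite $H\subset\mathbb N$, $(x_n)_{n\in H}$ is regarded as the sequence equal to $x_n$ for $n\in H$ and $0$ for $n\notin H$. $\mathbb K\in\mathcal K_\Xi$ is singular if there are $(L_n)_n\subset\mathcal M$ satisfying (Lip) with $(\psi_n)_n$, an infinite set $H\subset\mathbb N$ and $D^{(1)}\in\mathbb R^+$ such that: (a.1) $\int_GL_n(s,t)\,d\mu(t)\le D^{(1)}$ for all $s\in G$, $n\in H$; (a.2) $\int_GL_n(s,t)\,d\mu(s)\le D^{(1)}$ for all $t\in G$, $n\in H$; (a.3) $\overline\ell_{\mathbb R}((x_n)_{n\in\mathbb N})=\overline\ell_{\mathbb R}((x_n)_{n\in H})$ for every sequence in $\mathbb R_0^+$; (a.4) $\overline\ell((x_n)_{n\in\mathbb N})=\overline\ell((x_n)_{n\in H})$ for every sequence in $\mathbf X^+$. A singular $\mathbb K$ is $(M)$-singular if, with $B(s,\delta)=\{t\in G:d(s,t)\le\delta\}$: (b.1) $\int_GL_n(s,t)\,d\mu(t)>0$ for all $s\in G$, $n\in H$; (b.2) for each $A\in\mathcal A$ with $\mu(A)<+\infty$ there is $(A_n)_n$ in $\mathcal A$ with $\ell_{\mathbb R}((\mu(A_n))_n)=0$ and $\ell_{\mathbb R}\big(\big(\sup_{s\in A\setminus A_n}\int_{G\setminus B(s,\delta)}L_n(s,t)\,d\mu(t)\big)_n\big)=0$ for each $\delta>0$;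 (b.3) for each such $A$ there are $(D_n)_n$ in $\mathcal A$ with $\ell_{\mathbb R}((\mu(D_n))_n)=0$, $z\in\mathbf X^+\setminus\{0\}$ and an $(o)$-sequence $(\varepsilon_n)_n$ in $\mathbb R^+$ with $\bigvee_{u\in\mathbf X\setminus\{0\}}\bigvee_{s\in A\setminus D_n}\big|\int_GK_n(s,t,u)\,d\mu(t)-u\big|\le\varepsilon_nz$ for all $n\in H$. It is $(U)$-singular if (b.1) holds, and (b.2), (b.3) hold with $A\setminus A_n$ and $A\setminus D_n$ replaced by $A$ (no exceptional sets).
   Formalization: In the equicontinuity condition on Ξ, w is chosen before ε (otherwise the condition is vacuous and the claim false); in the (U) case suprema over A are asserted to exist only for n in H, and where a supremum does not exist in X its term may be any positive value. *)

(* Defs.v *)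
From HB Require Import structures.
From mathcomp Require Import all_boot all_order all_algebra.
From mathcomp Require Import all_classical all_reals all_analysis.

Set Implicit Arguments.
Unset Strict Implicit.
Unset Printing Implicit Defensive.

Import Order.TTheory GRing.Theory Num.Theory.

Local Open Scope classical_set_scope.
Local Open Scope ring_scope.

(** Binary meets are not required: [- vjoin (- x) (- y)] is the meet of [x] and
    [y]. *)
HB.mixin Record isDedekindVectorLattice (R : realType) Y
    & GRing.Lmodule R Y & Num.POrderedZmodule Y := {
  vjoin : Y -> Y -> Y ;
  vjoin_le : forall x y z, (vjoin x y <= z) = (x <= z) && (y <= z) ;
  lev_add2r : forall x y z : Y, x <= y -> x + z <= y + z ;
  lev_wpscale : forall (a : R) (x y : Y), 0 <= a -> x <= y -> a *: x <= a *: y ;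
  dedekind_complete : forall A : set Y, has_sup A -> supremums A !=set0
}.

#[short(type="dvlatticeType")]
HB.structure Definition DedekindVectorLattice (R : realType) :=
  { Y of GRing.Lmodule R Y & Num.POrderedZmodule Y
       & isDedekindVectorLattice R Y }.

Section regular_dvlattice.
Variable R : realType.

HB.instance Definition _ := Num.POrderedZmodule.copy R^o R.

Let reg_join_le (x y z : R^o) :
  ((Num.max x y : R^o) <= z) = (x <= z) && (y <= z).
Proof. exact: (@ge_max _ R). Qed.

Let reg_add2r (x y z : R^o) : x <= y -> x + z <= y + z.
Proof. by move=> xy; rewrite (@lerD2r R). Qed.

Let reg_wpscale (a : R) (x y : R^o) : 0 <= a -> x <= y -> a *: x <= a *: y.
Proof. by move=> a0 xy; exact: (@ler_wpM2l R). Qed.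

Let reg_complete (A : set R^o) : has_sup A -> supremums A !=set0.
Proof.
move=> supA; exists (sup (A : set R)); split.
- by move=> x Ax; exact: (@sup_upper_bound R A supA).
- by move=> y Ay; apply: (@ge_sup R A) => //; exact: supA.1.
Qed.

HB.instance Definition _ :=
  isDedekindVectorLattice.Build R R^o reg_join_le reg_add2r reg_wpscale reg_complete.

End regular_dvlattice.

(** [measurableType] structures live on pointed types. *)
#[short(type="pointedMetricType")]
HB.structure Definition PointedMetric (R : realType) :=
  { G of Metric R G & Pointed G }.

Notation borel G := (g_sigma_algebraType (@open G)).

Section lattice_operations.
Context {R : realType} {Y : dvlatticeType R}.

Definition vabs (x : Y) : Y := vjoin x (- x).
Definition vpos (x : Y) : Y := vjoin x 0.
Definition vneg (x : Y) : Y := vjoin (- x) 0.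

Definition osequence (x : nat -> Y) : Prop :=
  (forall n, x n.+1 <= x n) /\ infimums (range x) 0.

End lattice_operations.

(** The half-line [Y^+ U {+oo}]; positivity of the finite values is imposed
    where it is used. *)
Variant ext (Y : Type) := Fin of Y | Infty.
Arguments Fin {Y}.
Arguments Infty {Y}.

Section extended.
Context {R : realType} {Y : dvlatticeType R}.

Definition ext_ge0 (x : ext Y) : Prop :=
  if x is Fin a then 0 <= a else True.

Definition ext_le (x y : ext Y) : Prop :=
  match x, y with
  | _, Infty => True
  | Fin a, Fin b => a <= b
  | Infty, Fin _ => False
  end.

Definition ext_add (x y : ext Y) : ext Y :=
  if (x, y) is (Fin a, Fin b) then Fin (a + b) else Infty.

End extended.

Section extended_product.
Context {R : realType} {Y1 Y2 Y : dvlatticeType R}.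
Variable mul : Y1 -> Y2 -> Y.

Definition ext_mull (x : ext Y1) (y : Y2) : ext Y :=
  match x with
  | Fin a => Fin (mul a y)
  | Infty => if y == 0 then Fin 0 else Infty
  end.

Definition ext_mulr (x : Y1) (y : ext Y2) : ext Y :=
  match y with
  | Fin b => Fin (mul x b)
  | Infty => if x == 0 then Fin 0 else Infty
  end.

End extended_product.

(** A convergence [(cdom, clim)] together with its limit superior [climsup].
    [clim] is only meaningful on [cdom], and [climsup] only on sequences of
    positive elements. *)
Record convergence (R : realType) (Y : dvlatticeType R) := Convergence {
  cdom : set (nat -> Y) ;
  clim : (nat -> Y) -> Y ;
  climsup : (nat -> Y) -> ext Y ;
  cdomD : forall x y, cdom x -> cdom y -> cdom (fun n => x n + y n) ;
  cdomZ : forall (a : R) x, cdom x -> cdom (fun n => a *: x n) ;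
  climD : forall x y, cdom x -> cdom y ->
    clim (fun n => x n + y n) = clim x + clim y ;
  climZ : forall (a : R) x, cdom x -> clim (fun n => a *: x n) = a *: clim x ;
  clim_le : forall x y, cdom x -> cdom y ->
    (\forall n \near \oo, x n <= y n) -> clim x <= clim y ;
  clim_cst : forall x c, (\forall n \near \oo, x n = c) ->
    cdom x /\ clim x = c ;
  clim_near : forall x y, cdom x -> (\forall n \near \oo, x n = y n) ->
    cdom y /\ clim y = clim x ;
  clim_abs : forall x, cdom x ->
    cdom (fun n => vabs (x n)) /\ clim (fun n => vabs (x n)) = vabs (clim x) ;
  cdom_squeeze : forall x y z, cdom x -> cdom z -> clim x = clim z ->
    (\forall n \near \oo, x n <= y n /\ y n <= z n) -> cdom y ;
  clim_harmonic : forall u, 0 <= u ->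
    cdom (fun n => n.+1%:R^-1 *: u) /\ clim (fun n => n.+1%:R^-1 *: u) = 0 ;
  climsup_ge0 : forall x, (forall n, 0 <= x n) -> ext_ge0 (climsup x) ;
  climsup_near : forall x y, (forall n, 0 <= x n) -> (forall n, 0 <= y n) ->
    (\forall n \near \oo, x n = y n) -> climsup x = climsup y ;
  climsupD : forall x y, (forall n, 0 <= x n) -> (forall n, 0 <= y n) ->
    ext_le (climsup (fun n => x n + y n)) (ext_add (climsup x) (climsup y)) ;
  climsup_le : forall x y, (forall n, 0 <= x n) -> (forall n, 0 <= y n) ->
    (\forall n \near \oo, x n <= y n) -> ext_le (climsup x) (climsup y) ;
  climsup_clim : forall x, (forall n, 0 <= x n) -> cdom x ->
    climsup x = Fin (clim x) ;
  climsup_eq0 : forall x, (forall n, 0 <= x n) -> climsup x = Fin 0 ->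
    cdom x /\ clim x = 0
}.

Definition cv {R : realType} {Y : dvlatticeType R} (c : convergence Y)
  (x : nat -> Y) (a : Y) : Prop := cdom c x /\ clim c x = a.

(** The suprema of the families [F n] of positive elements exist in [Y] and
    form a sequence with limit [a]; [supremum 0 set0 = 0]. *)
Definition cv_sup {R : realType} {Y : dvlatticeType R} (c : convergence Y)
    (F : nat -> set Y) (a : Y) : Prop :=
  (forall n, has_ubound (F n)) /\ cv c (fun n => supremum 0 (F n)) a.

(** Variant of [cv_sup c F 0] relative to an index set [H] off which [c] does
    not see the values of positive sequences: the suprema have to exist in [Y]
    for [n] in [H] only, and a supremum that does not exist may be given any
    value in [Y^+].  It is [cv_sup c F 0] if all the families are bounded.
    Uniform convergence of the operators is stated with it because singularity
    says nothing on [K n] for [n] off [H], where [operator K n f] may be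
    unbounded. *)
Definition cv_sup0_along {R : realType} {Y : dvlatticeType R}
    (c : convergence Y) (H : set nat) (F : nat -> set Y) : Prop :=
  (forall n, H n -> has_ubound (F n)) /\
  forall x : nat -> Y, (forall n, 0 <= x n) ->
    (forall n, has_ubound (F n) -> x n = supremum 0 (F n)) -> cv c x 0.

Record product_triple (R : realType) (Y1 Y2 Y : dvlatticeType R)
    (c1 : convergence Y1) (c2 : convergence Y2) (c : convergence Y)
    (mul : Y1 -> Y2 -> Y) : Prop := ProductTriple {
  ptDl : forall x1 y1 x2, mul (x1 + y1) x2 = mul x1 x2 + mul y1 x2 ;
  ptDr : forall x1 x2 y2, mul x1 (x2 + y2) = mul x1 x2 + mul x1 y2 ;
  pt_lel : forall x1 y1 x2, y1 <= x1 -> 0 <= x2 -> mul y1 x2 <= mul x1 x2 ;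
  pt_ler : forall x1 x2 y2, 0 <= x1 -> y2 <= x2 -> mul x1 y2 <= mul x1 x2 ;
  pt_ol : forall x y, osequence x -> 0 <= y -> osequence (fun n => mul (x n) y) ;
  pt_or : forall x y, 0 <= x -> osequence y -> osequence (fun n => mul x (y n)) ;
  pt_cvl : forall x y, cv c1 x 0 -> cv c (fun n => mul (x n) y) 0 ;
  pt_cvr : forall x y, cv c2 y 0 -> cv c (fun n => mul x (y n)) 0 ;
  pt_limsupl : forall x (a : ext Y1) y, (forall n, 0 <= x n) -> 0 <= y ->
    climsup c1 x = a -> climsup c (fun n => mul (x n) y) = ext_mull mul a y ;
  pt_limsupr : forall x y (b : ext Y2), 0 <= x -> (forall n, 0 <= y n) ->
    climsup c2 y = b -> climsup c (fun n => mul x (y n)) = ext_mulr mul x b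
}.

Section condition_Hstar.
Context {R : realType} {X : dvlatticeType R}.
Variables (ellR : convergence R^o) (ell : convergence X).

Definition enorm (e x : X) : R :=
  inf [set eps : R | 0 < eps /\ vabs x <= eps *: e].

Definition condition_Hstar : Prop :=
  forall (e : X) (x : nat -> X), 0 < e ->
    (forall n, exists d : R, 0 < d /\ vabs (x n) <= d *: e) ->
    cv ellR (fun n => enorm e (x n)) 0 ->
    cv ell (fun n => vabs (x n)) 0.

End condition_Hstar.

Definition regular_measure {R : realType} {G : pointedMetricType R}
    (mu : {measure set (borel G) -> \bar R}) : Prop :=
  (forall C : set G, compact C -> (mu C < +oo)%E) /\
  (forall (eps : R) (E : set (borel G)), 0 < eps -> measurable E ->
    exists C U : set G, [/\ compact C, C `<=` E, open U, E `<=` U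
                          & (mu (U `\` C) <= eps%:E)%E]).

Section integral.
Context {R : realType} {G : pointedMetricType R}.
Variables (mu : {measure set (borel G) -> \bar R}) (ellR : convergence R^o).

Definition fin_measurable (A : set (borel G)) : Prop :=
  measurable A /\ (mu A < +oo)%E.

(** [mu (A n)] is a sequence in [R], hence finite. *)
Definition cv_mu0 (A : nat -> set (borel G)) : Prop :=
  (forall n, (mu (A n) < +oo)%E) /\ cv ellR (fun n => fine (mu (A n))) 0.

Context {Y : dvlatticeType R}.
Variable ellY : convergence Y.

Definition simple_repr (f : G -> Y) (r : nat) (c : 'I_r -> Y)
    (B : 'I_r -> set (borel G)) : Prop :=
  (forall j, fin_measurable (B j)) /\
  (forall g, f g = \sum_(j < r) (\1_(B j) g : R) *: c j).

Definition is_simple (f : G -> Y) : Prop :=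
  exists r (c : 'I_r -> Y) (B : 'I_r -> set (borel G)), simple_repr f c B.

Definition simple_integral (f : G -> Y) (A : set (borel G)) : Y :=
  xget 0 [set v | exists r (c : 'I_r -> Y) (B : 'I_r -> set (borel G)),
    simple_repr f c B /\ v = \sum_(j < r) fine (mu (A `&` B j)) *: c j].

Definition cv_in_measure (fs : nat -> G -> Y) (f : G -> Y)
    (A : set (borel G)) : Prop :=
  exists An : nat -> set (borel G),
    [/\ forall n, measurable (An n),
        cv_mu0 (fun n => A `&` An n)
      & cv_sup ellY
          (fun n => [set vabs (fs n g - f g) | g in A `\` An n]) 0].

Definition cv_uniform_along (H : set nat) (fs : nat -> G -> Y) (f : G -> Y)
    (A : set (borel G)) : Prop :=
  cv_sup0_along ellY H (fun n => [set vabs (fs n g - f g) | g in A]).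

Definition equi_abs_continuous (fs : nat -> G -> Y) : Prop :=
  (forall An : nat -> set (borel G), (forall n, measurable (An n)) ->
     cv_mu0 An ->
     cv ellY (fun n => simple_integral (fun g => vabs (fs n g)) (An n)) 0) /\
  (exists B : nat -> set (borel G),
     [/\ forall m, fin_measurable (B m),
         forall m, B m `<=` B m.+1
       & exists y : nat -> Y,
         (forall m, climsup ellY
            (fun n => simple_integral (fun g => vabs (fs n g)) (~` B m)) =
            Fin (y m)) /\ cv ellY y 0]).

Definition defining (fs : nat -> G -> Y) (f : G -> Y) : Prop :=
  [/\ forall n, is_simple (fs n),
      forall A, fin_measurable A -> cv_in_measure fs f A
    & equi_abs_continuous fs].

Definition is_pos_integral (f : G -> Y) (l : set (borel G) -> Y) : Prop :=
  exists fs : nat -> G -> Y, defining fs f /\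
    cv_sup ellY (fun n =>
      [set vabs (simple_integral (fs n) A - l A) | A in measurable]) 0.

Definition pos_integral (f : G -> Y) (A : set (borel G)) : Y :=
  xget 0 [set v | exists l, is_pos_integral f l /\ v = l A].

Definition vintegrable (f : G -> Y) : Prop :=
  (exists l, is_pos_integral (fun g => vpos (f g)) l) /\
  (exists l, is_pos_integral (fun g => vneg (f g)) l).

Definition vintegral (A : set (borel G)) (f : G -> Y) : Y :=
  pos_integral (fun g => vpos (f g)) A - pos_integral (fun g => vneg (f g)) A.

End integral.

Section functions.
Context {R : realType} {X : dvlatticeType R} {G : pointedMetricType R}.

Definition unif_continuous (f : G -> X) : Prop :=
  exists u : X, 0 <= u /\
    forall eps : R, 0 < eps -> exists delta : R, 0 < delta /\
      forall g1 g2, mdist g1 g2 <= delta -> vabs (f g1 - f g2) <= eps *: u.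

Definition Cc (f : G -> X) : Prop :=
  unif_continuous f /\ compact (closure [set g | f g != 0]).

Definition unif_continuous_pos (psi : X -> X) : Prop :=
  forall (u : X) (eps : R), 0 <= u -> 0 < eps ->
    exists (w : X) (delta : R), [/\ 0 <= w, 0 < delta
      & forall x1 x2, 0 <= x1 -> 0 <= x2 ->
          vabs (x1 - x2) <= delta *: u ->
          vabs (psi x1 - psi x2) <= eps *: w].

(** Maps [X^+ -> X^+] are maps on [X] of which only the values on [X^+]
    matter. *)
Record Psi (psi : X -> X) : Prop := MkPsi {
  Psi_ge0 : forall x, 0 <= x -> 0 <= psi x ;
  Psi_uc : unif_continuous_pos psi ;
  Psi_incr : forall x y, 0 <= x -> x <= y -> psi x <= psi y ;
  Psi_0 : psi 0 = 0 ;
  Psi_gt0 : forall v, 0 < v -> 0 < psi v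
}.

(** In [Xi_equi0] the element [w] is chosen before [eps].  If it could depend
    on [eps], the condition would follow from [Xi_bounded] (take
    [w = eps^-1 *: A_u] and [delta = 1]). *)
Record Xi (psi : nat -> X -> X) : Prop := MkXi {
  Xi_Psi : forall n, Psi (psi n) ;
  Xi_equi0 : forall u : X, 0 < u -> exists w : X, 0 < w /\
    forall eps : R, 0 < eps -> exists delta : R, 0 < delta /\
      forall n x, 0 <= x -> x <= delta *: u -> psi n x <= eps *: w ;
  Xi_bounded : forall v : X, 0 <= v -> exists A : X, 0 < A /\
    forall n, psi n v <= A
}.

Definition convex_map (mul : X -> X -> X) (phi : X -> X) : Prop :=
  exists beta : X -> X,
    (forall v s, phi v + mul (beta v) (s - v) <= phi s) /\
    (forall u, 0 < u -> exists a b : X,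
       forall v, - u <= v -> v <= u -> a <= beta v /\ beta v <= b).

Record modular_map (mul : X -> X -> X) (phi : X -> X) : Prop := MkModularMap {
  phi_convex : convex_map mul phi ;
  phi_incr : forall x y, 0 <= x -> x <= y -> phi x <= phi y ;
  phi_0 : phi 0 = 0 ;
  phi_gt0 : forall x, 0 < x -> 0 < phi x
}.

End functions.

Section kernels.
Context {R : realType} {X : dvlatticeType R} {G : pointedMetricType R}.
Variables (mu : {measure set (borel G) -> \bar R}).
Variables (ellR : convergence R^o) (ell : convergence X).

Definition bounded_on_fin (h : G -> R) : Prop :=
  forall A : set (borel G), fin_measurable mu A ->
    exists M : R, forall g, A g -> h g <= M.

Record scalar_kernel (L : G -> G -> R) : Prop := ScalarKernel {
  sk_ge0 : forall s t, 0 <= L s t ;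
  sk_measurable :
    measurable_fun setT (fun p : borel G * borel G => L p.1 p.2) ;
  sk_integrable1 : forall t, vintegrable mu ellR ellR (fun s => L s t) ;
  sk_integrable2 : forall s, vintegrable mu ellR ellR (L s) ;
  sk_bounded1 : forall t, bounded_on_fin (fun s => L s t) ;
  sk_bounded2 : forall s, bounded_on_fin (L s)
}.

Definition Lipschitz (psi : nat -> X -> X) (K : nat -> G -> G -> X -> X)
    (L : nat -> G -> G -> R) : Prop :=
  forall n s t u v,
    vabs (K n s t u - K n s t v) <= L n s t *: psi n (vabs (u - v)).

Record K_class (psi : nat -> X -> X) (K : nat -> G -> G -> X -> X) : Prop :=
    MkKClass {
  K_integrable1 : forall n t u, vintegrable mu ellR ell (fun s => K n s t u) ;
  K_integrable2 : forall n s u, vintegrable mu ellR ell (fun t => K n s t u) ;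
  K_0 : forall n s t, K n s t 0 = 0 ;
  K_Lip : exists L : nat -> G -> G -> R,
    (forall n, scalar_kernel (L n)) /\ Lipschitz psi K L
}.

Definition operator_dom (K : nat -> G -> G -> X -> X) (f : G -> X) : Prop :=
  forall n s, vintegrable mu ellR ell (fun t => K n s t (f t)).

Definition operator (K : nat -> G -> G -> X -> X) (n : nat) (f : G -> X)
    (s : G) : X :=
  vintegral mu ellR ell setT (fun t => K n s t (f t)).

Definition zero_off {Y : nmodType} (H : set nat) (x : nat -> Y) : nat -> Y :=
  fun n => if n \in H then x n else 0.

Record singular (psi : nat -> X -> X) (K : nat -> G -> G -> X -> X)
    (L : nat -> G -> G -> R) (H : set nat) : Prop := MkSingular {
  sing_kernel : forall n, scalar_kernel (L n) ;
  sing_Lip : Lipschitz psi K L ;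
  sing_infinite : infinite_set H ;
  sing_bound : exists D : R, [/\ 0 < D,
    forall s n, H n -> vintegral mu ellR ellR setT (L n s) <= D
  & forall t n, H n -> vintegral mu ellR ellR setT (fun s => L n s t) <= D] ;
  sing_limsupR : forall x : nat -> R^o, (forall n, 0 <= x n) ->
    climsup ellR x = climsup ellR (zero_off H x) ;
  sing_limsup : forall x : nat -> X, (forall n, 0 <= x n) ->
    climsup ell x = climsup ell (zero_off H x)
}.

Definition mass_gt0 (L : nat -> G -> G -> R) (H : set nat) : Prop :=
  forall s n, H n -> (0 : R) < vintegral mu ellR ellR setT (L n s).

Definition cball (s : G) (delta : R) : set G := [set t | mdist s t <= delta].

Definition vanishing_tails (L : nat -> G -> G -> R)
    (S : nat -> set (borel G)) : Prop :=
  forall delta : R, 0 < delta ->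
    cv_sup ellR (fun n =>
      [set vintegral mu ellR ellR (~` cball s delta) (L n s) | s in S n]) 0.

Definition approx_identity (K : nat -> G -> G -> X -> X) (H : set nat)
    (S : nat -> set (borel G)) : Prop :=
  exists (z : X) (eps : nat -> R^o),
    [/\ 0 < z, forall n, 0 < eps n, osequence eps
      & forall n, H n ->
        let F := [set vabs (vintegral mu ellR ell setT (fun t => K n s t u) - u)
                   | u in [set u | u != 0] & s in S n] in
        has_ubound F /\ supremum 0 F <= (eps n : R) *: z].

Record M_singular (psi : nat -> X -> X) (K : nat -> G -> G -> X -> X)
    (L : nat -> G -> G -> R) (H : set nat) : Prop := MkMSingular {
  M_sing : singular psi K L H ;
  M_mass : mass_gt0 L H ;
  M_tails : forall A, fin_measurable mu A ->
    exists An : nat -> set (borel G),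
      [/\ forall n, measurable (An n), cv_mu0 mu ellR An
        & vanishing_tails L (fun n => A `\` An n)] ;
  M_approx : forall A, fin_measurable mu A ->
    exists Dn : nat -> set (borel G),
      [/\ forall n, measurable (Dn n), cv_mu0 mu ellR Dn
        & approx_identity K H (fun n => A `\` Dn n)]
}.

Record U_singular (psi : nat -> X -> X) (K : nat -> G -> G -> X -> X)
    (L : nat -> G -> G -> R) (H : set nat) : Prop := MkUSingular {
  U_sing : singular psi K L H ;
  U_mass : mass_gt0 L H ;
  U_tails : forall A, fin_measurable mu A -> vanishing_tails L (fun=> A) ;
  U_approx : forall A, fin_measurable mu A -> approx_identity K H (fun=> A)
}.

End kernels.

(* Main.v *)
(** Write [T_n f s - f s] as the integral of [K_n(s,t,f t) - K_n(s,t,f s)] in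
    [t], plus [\int K_n(s,t,f s) dt - f s], which is at most [eps_n z].  By the
    Lipschitz condition the integrand is at most [L_n(s,t) e w] on a ball around
    [s], by uniform continuity of [f], and at most [L_n(s,t) a] elsewhere, [f]
    being bounded.  Hence the difference is at most [e D w + sigma_n a + eps_n z]
    where [sigma_n], bounding the mass of [L_n(s,.)] off the ball, tends to [0];
    as [w] does not depend on [e], the limit superior of the suprema vanishes.
    Near [0] the convex map is dominated by a multiplication, [0 <= phi x <= b x].

    The integral is accessible only through its defining sequences, so the
    comparison rests on its monotonicity: if [f <= h] pointwise and [f_n], [h_n]
    are defining for them, the simple functions [(f_n - h_n)^+] form a defining
    sequence for [0], and their integrals tend to [0]. *)
Require Import Defs.
From mathcomp Require Import all_boot all_order all_algebra.
From mathcomp Require Import all_classical all_reals all_analysis.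

Set Implicit Arguments.
Unset Strict Implicit.
Unset Printing Implicit Defensive.

Import Order.TTheory GRing.Theory Num.Theory.

Local Open Scope classical_set_scope.
Local Open Scope ring_scope.

(** * Vector lattices and convergences *)

Section lattice.
Context {R : realType} {Y : dvlatticeType R}.
Implicit Types (x y z : Y) (a b : R).

Lemma lev_add2l z x y : x <= y -> z + x <= z + y.
Proof. by move=> xy; rewrite ![z + _]addrC; exact: lev_add2r. Qed.

Lemma lev_add x y z t : x <= y -> z <= t -> x + z <= y + t.
Proof.
by move=> xy zt; exact: le_trans (lev_add2r _ _ z xy) (lev_add2l _ zt).
Qed.

Lemma subv_ge0 x y : (0 <= y - x) = (x <= y).
Proof.
apply/idP/idP => [h|/(lev_add2r _ _ (- x))]; last by rewrite subrr.
by have := lev_add2r _ _ x h; rewrite subrK add0r.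
Qed.

Lemma subv_le0 x y : (y - x <= 0) = (y <= x).
Proof.
apply/idP/idP => [h|/(lev_add2r _ _ (- x))]; last by rewrite subrr.
by have := lev_add2r _ _ x h; rewrite subrK add0r.
Qed.

Lemma levN2 x y : (- x <= - y) = (y <= x).
Proof. by rewrite -[LHS]subv_ge0 opprK addrC subv_ge0. Qed.

Lemma addv_ge0 x y : 0 <= x -> 0 <= y -> 0 <= x + y.
Proof. by move=> x0 y0; rewrite -[0]addr0; exact: lev_add. Qed.

Lemma scalev_ge0 a x : 0 <= a -> 0 <= x -> 0 <= a *: x.
Proof. by move=> a0 x0; have := lev_wpscale _ _ _ a0 x0; rewrite scaler0. Qed.

Lemma lev_wscale2r a b x : 0 <= x -> a <= b -> a *: x <= b *: x.
Proof.
by move=> x0 ab; rewrite -subv_ge0 -scalerBl scalev_ge0// subr_ge0.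
Qed.

Lemma sumv_ge0 (I : Type) (r : seq I) (F : I -> Y) :
  (forall i, 0 <= F i) -> 0 <= \sum_(i <- r) F i.
Proof. by move=> F0; elim/big_ind : _ => // x y; exact: addv_ge0. Qed.

Lemma le_vjoinl x y : x <= vjoin x y.
Proof. by have := lexx (vjoin x y); rewrite vjoin_le => /andP[]. Qed.

Lemma le_vjoinr x y : y <= vjoin x y.
Proof. by have := lexx (vjoin x y); rewrite vjoin_le => /andP[]. Qed.

Lemma vjoin_idl x y : y <= x -> vjoin x y = x.
Proof. by move=> yx; apply/le_anti; rewrite vjoin_le lexx yx/= le_vjoinl. Qed.

Lemma vabs_le x y : (vabs x <= y) = (x <= y) && (- x <= y).
Proof. exact: vjoin_le. Qed.

Lemma le_vabs x : x <= vabs x. Proof. exact: le_vjoinl. Qed.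

Lemma le_vabsN x : - x <= vabs x. Proof. exact: le_vjoinr. Qed.

Lemma vabsN x : vabs (- x) = vabs x.
Proof.
have h y : vabs (- y) <= vabs y by rewrite vabs_le opprK le_vabs le_vabsN.
by apply/le_anti; rewrite h -{1}[x]opprK h.
Qed.

Lemma vdistC x y : vabs (x - y) = vabs (y - x).
Proof. by rewrite -vabsN opprB. Qed.

(** Adding [x <= vabs x] and [- x <= vabs x] gives [0 <= 2 *: vabs x], which is then halved. *)
Lemma vabs_ge0 x : 0 <= vabs x.
Proof.
have h : 0 <= (2 : R) *: vabs x.
  rewrite -[X in X *: _]/(1 + 1 : R) scalerDl scale1r -(subrr x).
  exact: lev_add (le_vabs x) (le_vabsN x).
have i2 : 0 <= (2^-1 : R) by rewrite invr_ge0.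
by have := scalev_ge0 i2 h; rewrite scalerA mulVf// scale1r.
Qed.

Lemma ger0_vabs x : 0 <= x -> vabs x = x.
Proof.
move=> x0; apply: vjoin_idl; apply: le_trans (x0).
by rewrite -oppr0 levN2.
Qed.

Lemma vabs0 : vabs (0 : Y) = 0. Proof. exact: ger0_vabs. Qed.

Lemma vabsD x y : vabs (x + y) <= vabs x + vabs y.
Proof. by rewrite vabs_le lev_add ?le_vabs//= opprD lev_add ?le_vabsN. Qed.

Lemma vabsB x y : vabs (x - y) <= vabs x + vabs y.
Proof. by rewrite -(vabsN y); exact: vabsD. Qed.

Lemma vabsZ_ge0 a x : 0 <= a -> vabs (a *: x) = a *: vabs x.
Proof.
rewrite le_eqVlt => /predU1P[<-|a0]; first by rewrite !scale0r vabs0.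
apply/le_anti/andP; split.
  by rewrite vabs_le -scalerN !lev_wpscale ?le_vabs ?le_vabsN// ltW.
have ai : 0 <= a^-1 by rewrite invr_ge0 ltW.
rewrite -[leRHS]scale1r -(divff (lt0r_neq0 a0)) -scalerA.
apply: lev_wpscale; first exact: ltW.
rewrite vabs_le; apply/andP; split.
  rewrite -[leLHS]scale1r -(mulVf (lt0r_neq0 a0)) -scalerA.
  by apply: lev_wpscale => //; exact: le_vabs.
rewrite -[leLHS]scale1r -(mulVf (lt0r_neq0 a0)) -scalerA scalerN.
by apply: lev_wpscale => //; exact: le_vabsN.
Qed.

Lemma vpos_ge0 x : 0 <= vpos x. Proof. exact: le_vjoinr. Qed.

Lemma le_vpos x : x <= vpos x. Proof. exact: le_vjoinl. Qed.

Lemma vpos_le x y : x <= y -> 0 <= y -> vpos x <= y.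
Proof. by move=> xy y0; rewrite vjoin_le xy. Qed.

Lemma vneg_ge0 x : 0 <= vneg x. Proof. exact: le_vjoinr. Qed.

(** The element [x + vneg x] is an upper bound of [x] and [0], and [vpos x - x] one of [- x] and
    [0]; minimality of the two joins gives the two inequalities. *)
Lemma vposB_vneg x : vpos x - vneg x = x.
Proof.
have n1 : 0 <= x + vneg x by rewrite addrC -{2}(opprK x) subv_ge0 le_vjoinl.
have n2 : 0 <= vpos x - x by rewrite subv_ge0 le_vpos.
apply/eqP; rewrite subr_eq; apply/eqP/le_anti/andP; split.
  by rewrite vjoin_le n1 andbT -[leLHS]addr0 lev_add2l ?vneg_ge0.
have h : vneg x <= vpos x - x.
  by rewrite vjoin_le n2 andbT -[leLHS]add0r lev_add2r ?vpos_ge0.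
by have := lev_add2l x h; rewrite (addrC x (vpos x - x)) subrK.
Qed.

End lattice.

Lemma vabs_scale (R : realType) (Y : dvlatticeType R) (r : R^o) (w : Y) :
  0 <= w -> vabs (r *: w) = vabs r *: w.
Proof.
move=> w0; have [r0|r0] := leP 0 (r : R).
  by rewrite ger0_vabs ?scalev_ge0// [in RHS]ger0_vabs.
have Nr0 : 0 <= - r :> R^o by rewrite oppr_ge0 ltW.
by rewrite -[in LHS](opprK r) scaleNr vabsN -[in RHS]vabsN !ger0_vabs ?scalev_ge0.
Qed.

(** * Suprema of families, with value [0] on the empty one *)

Section supremum.
Context {R : realType} {Y : dvlatticeType R}.
Implicit Types (A : set Y) (x y : Y).

Lemma le_supremum A x : has_ubound A -> A x -> x <= supremum 0 A.
Proof.
move=> ubA Ax; rewrite /supremum ifF; last first.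
  by apply/negbTE/set0P; exists x.
have /dedekind_complete[y Ay] : has_sup A by split=> //; exists x.
by have [/(_ x Ax)] := xgetI 0 Ay.
Qed.

Lemma supremum_le A y : 0 <= y -> ubound A y -> supremum 0 A <= y.
Proof.
move=> y0 Ay; have [->|/set0P[x Ax]] := eqVneq A set0; first by rewrite supremum0.
have /dedekind_complete[z Az] : has_sup A by split; [exists x|exists y].
rewrite /supremum ifF; last by apply/negbTE/set0P; exists x.
by have [_] := xgetI 0 Az; apply.
Qed.

(** If [A] has no least upper bound, [supremum] takes its default value [0]. *)
Lemma supremum_ge0 A : (forall x, A x -> 0 <= x) -> 0 <= supremum 0 A.
Proof.
move=> A0; have [->|/set0P[x Ax]] := eqVneq A set0; first by rewrite supremum0.
rewrite /supremum; case: ifPn => // _; case: xgetP => // y _ [Ay _].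
exact: le_trans (A0 _ Ax) (Ay _ Ax).
Qed.

End supremum.

(** * Calculus of abstract convergences and limits superior *)

Section convergence.
Context {R : realType} {Y : dvlatticeType R} (c : convergence Y).
Implicit Types (x y z : nat -> Y) (a b : Y).

Lemma cv_cst a : cv c (fun=> a) a.
Proof. by have [? ?] := clim_cst c (nearW _ (fun=> erefl a)). Qed.

Lemma cvD x y a b : cv c x a -> cv c y b -> cv c (fun n => x n + y n) (a + b).
Proof. by move=> [? <-] [? <-]; split; [exact: cdomD|exact: climD]. Qed.

Lemma cvZ (k : R) x a : cv c x a -> cv c (fun n => k *: x n) (k *: a).
Proof. by move=> [? <-]; split; [exact: cdomZ|exact: climZ]. Qed.

Lemma eq_cv x y a : x =1 y -> cv c x a -> cv c y a.
Proof. by move=> /funext ->. Qed.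

Lemma cvN x a : cv c x a -> cv c (fun n => - x n) (- a).
Proof.
by move=> /(cvZ (-1)); rewrite scaleN1r; apply: eq_cv => n; rewrite scaleN1r.
Qed.

Lemma cvB x y a b : cv c x a -> cv c y b -> cv c (fun n => x n - y n) (a - b).
Proof. by move=> xa /cvN; exact: cvD. Qed.

Lemma cvB0 x a : cv c (fun n => x n - a) 0 -> cv c x a.
Proof.
move=> /cvD-/(_ _ _ (cv_cst a)); rewrite add0r.
by apply: eq_cv => n; rewrite subrK.
Qed.

Lemma cv_abs x : cv c x 0 -> cv c (fun n => vabs (x n)) 0.
Proof. by move=> [/clim_abs[? +] x0]; rewrite x0 vabs0. Qed.

Lemma cv_le x y a b : (forall n, x n <= y n) -> cv c x a -> cv c y b -> a <= b.
Proof. by move=> xy [? <-] [? <-]; apply: clim_le => //; exact: nearW. Qed.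

Lemma cv_squeeze x y z a : (forall n, x n <= y n) -> (forall n, y n <= z n) ->
  cv c x a -> cv c z a -> cv c y a.
Proof.
move=> xy yz xa za; have dy : cdom c y.
  apply: (cdom_squeeze xa.1 za.1); first by rewrite xa.2 za.2.
  exact: nearW.
split=> //; apply/le_anti/andP; split.
  by apply: cv_le yz _ za.
by apply: cv_le xy xa _.
Qed.

Lemma cv_squeeze0 x y : (forall n, 0 <= x n) -> (forall n, x n <= y n) ->
  cv c y 0 -> cv c x 0.
Proof. by move=> x0 xy; apply: cv_squeeze (cv_cst 0). Qed.

Lemma cv_dist x y a : (forall n, vabs (x n - a) <= y n) -> cv c y 0 -> cv c x a.
Proof.
move=> xy y0; apply: cvB0; apply: (@cv_squeeze (fun n => - y n) _ y) => //.
- by move=> n; rewrite -[leRHS]opprK levN2; exact: le_trans (le_vabsN _) (xy n).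
- by move=> n; exact: le_trans (le_vabs _) (xy n).
- by rewrite -oppr0; exact: cvN.
Qed.

Lemma climsup_cv x a : (forall n, 0 <= x n) -> cv c x a -> climsup c x = Fin a.
Proof. by move=> x0 [dx <-]; exact: climsup_clim. Qed.

(** A null summand does not raise the limit superior. Neither [x] nor [y] has to converge. *)
Lemma climsup_le_cv0 x y z a : (forall n, 0 <= x n) -> (forall n, 0 <= y n) ->
  (forall n, 0 <= z n) -> (forall n, x n <= y n + z n) ->
  ext_le (climsup c y) (Fin a) -> cv c z 0 -> ext_le (climsup c x) (Fin a).
Proof.
move=> x0 y0 z0 xyz ya zc.
have yz0 n := addv_ge0 (y0 n) (z0 n).
have h1 : ext_le (climsup c x) (climsup c (fun n => y n + z n)).
  by apply: climsup_le => //; exact: nearW.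
have h2 := climsupD c y0 z0.
rewrite (climsup_cv z0 zc) in h2.
case: (climsup c y) ya h2 => // d /= da.
case: (climsup c (fun n => y n + z n)) h1 => // e.
case: (climsup c x) => //= f fe; rewrite addr0 => ed.
exact: le_trans fe (le_trans ed da).
Qed.

(** This concludes every epsilon-argument below: a limit superior under all terms of a null sequence
    is finite and equal to [0], which forces convergence. *)
Lemma climsup_cv0 x y : (forall n, 0 <= x n) -> cv c y 0 ->
  (forall m, ext_le (climsup c x) (Fin (y m))) -> cv c x 0.
Proof.
move=> x0 yc h; apply: climsup_eq0 => //.
have := climsup_ge0 c x0.
case: (climsup c x) h => [d /= h d0|/(_ 0%N)//].
by congr Fin; apply/le_anti; rewrite d0 (cv_le h (cv_cst _) yc).
Qed.

Lemma cv_harmonic a : 0 <= a -> cv c (fun n => n.+1%:R^-1 *: a) 0.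
Proof. exact: clim_harmonic. Qed.

Lemma climsup_fin x a : (forall n, 0 <= x n) ->
  ext_le (climsup c x) (Fin a) ->
  exists b, [/\ climsup c x = Fin b, 0 <= b & b <= a].
Proof.
move=> x0; have := climsup_ge0 c x0.
by case: (climsup c x) => [b b0 ba|_ []]; exists b.
Qed.

(** Singularity supplies the equality of limits superior, so convergence to [0] can be tested on [H]
    alone. *)
Lemma cv_zero_off (H : set nat) x :
  climsup c x = climsup c (zero_off H x) -> (forall n, 0 <= x n) ->
  cv c (zero_off H x) 0 -> cv c x 0.
Proof.
move=> e x0 h; apply: climsup_eq0 => //; rewrite e (climsup_cv _ h)// => n.
by rewrite /zero_off; case: ifP.
Qed.

Lemma cv_sup_dom (F : nat -> set Y) : cv_sup c F 0 ->
  exists y, [/\ forall n, 0 <= y n, cv c y 0 & forall n, ubound (F n) (y n)].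
Proof.
(* The elements of [F n] may have any sign here; the modulus makes the dominating sequence
   positive. *)
move=> [ubF cF]; exists (fun n => vabs (supremum 0 (F n))).
split; [by move=> n; exact: vabs_ge0|exact: cv_abs|].
by move=> n u Fu; apply: le_trans (le_vabs _); exact: le_supremum.
Qed.

Lemma dom_cv_sup (F : nat -> set Y) y : (forall n, 0 <= y n) -> cv c y 0 ->
  (forall n u, F n u -> 0 <= u) -> (forall n, ubound (F n) (y n)) ->
  cv_sup c F 0.
Proof.
move=> y0 yc F0 Fy; split; first by move=> n; exists (y n).
apply: cv_squeeze0 yc => n; first exact/supremum_ge0/F0.
exact: supremum_le.
Qed.

End convergence.

Lemma osequence_le (R : realType) (Y : dvlatticeType R) (x : nat -> Y) m n :
  osequence x -> (m <= n)%N -> x n <= x m.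
Proof.
move=> [dx _]; elim: n => [|n IH]; first by rewrite leqn0 => /eqP ->.
rewrite leq_eqVlt => /predU1P[->//|]; rewrite ltnS => /IH; exact: le_trans.
Qed.

(** The order of [R] is total, so a decreasing sequence with infimum [0] eventually drops below each
    [1 / (m + 1)], and so does its limit superior. *)
Lemma cv_osequence (R : realType) (c : convergence R^o) (x : nat -> R^o) :
  osequence x -> cv c x 0.
Proof.
move=> ox; have [dx [x0 xinf]] := ox.
have xge0 n : 0 <= x n by apply: x0; exists n.
have c1 := @cv_harmonic _ _ c (1 : R^o) ler01.
apply: (@climsup_cv0 _ _ c x _ xge0 c1) => m.
set e : R^o := _ *: _.
have e0 : 0 < (e : R) by rewrite /e /GRing.scale/= mulr1.
have [N xN] : exists N, x N <= e.
  apply: contrapT => h; have : (e : R^o) <= 0.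
    apply: xinf => _ [n _ <-]; rewrite leNgt; apply/negP => /ltW xe.
    by apply: h; exists n.
  by rewrite leNgt e0.
have e0' : 0 <= e := ltW e0.
have := @climsup_le _ _ c x (fun=> e) xge0 (fun=> e0').
rewrite (climsup_cv (fun=> e0') (cv_cst c e)); apply.
by exists N => // n /= Nn; exact: le_trans (osequence_le ox Nn) xN.
Qed.

(** * Simple functions *)

Section finite_measure.
Context {R : realType} {G : pointedMetricType R}.
Variable mu : {measure set (borel G) -> \bar R}.
Implicit Types A B : set (borel G).

Lemma fin_measurableW A B : fin_measurable mu B -> measurable A ->
  A `<=` B -> fin_measurable mu A.
Proof.
move=> [mB Boo] mA AB; split=> //; apply: le_lt_trans Boo.
by apply: le_measure; rewrite ?inE.
Qed.

Lemma fin_measurableIr A B : fin_measurable mu B -> measurable A ->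
  fin_measurable mu (A `&` B).
Proof.
move=> fB mA; apply: (fin_measurableW fB) => //.
by apply: measurableI => //; exact: fB.1.
Qed.

Lemma fin_measurableU A B : fin_measurable mu A -> fin_measurable mu B ->
  fin_measurable mu (A `|` B).
Proof.
move=> [mA Aoo] [mB Boo]; split; first exact: measurableU.
by apply: le_lt_trans (measureU2 mu mA mB) _; exact: lte_add_pinfty.
Qed.

Lemma fin_measurable_fin_num A : fin_measurable mu A -> mu A \is a fin_num.
Proof. by move=> [_ Aoo]; rewrite ge0_fin_numE. Qed.

Lemma fine_mu_ge0 A : 0 <= fine (mu A).
Proof. exact: fine_ge0. Qed.

Lemma fine_mu_le A B : fin_measurable mu B -> measurable A -> A `<=` B ->
  fine (mu A) <= fine (mu B).
Proof.
move=> fB mA AB; have fA := fin_measurableW fB mA AB.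
apply: fine_le; [exact: fin_measurable_fin_num..|].
by apply: le_measure; rewrite ?inE//; exact: fB.1.
Qed.

Lemma fine_muU_le A B : fin_measurable mu A -> fin_measurable mu B ->
  fine (mu (A `|` B)) <= fine (mu A) + fine (mu B).
Proof.
move=> fA fB; rewrite -fineD ?fin_measurable_fin_num//.
apply: fine_le; rewrite ?fin_numD ?fin_measurable_fin_num//.
  exact: fin_measurableU.
by apply: measureU2; [exact: fA.1|exact: fB.1].
Qed.

Lemma fine_muID A B : fin_measurable mu A -> measurable B ->
  fine (mu A) = fine (mu (A `&` B)) + fine (mu (A `\` B)).
Proof.
move=> fA mB; rewrite (measureDI mu fA.1 mB) fineD; first by rewrite addrC.
- apply/fin_measurable_fin_num/(fin_measurableW fA); last exact: subDsetl.
  by apply: measurableD => //; exact: fA.1.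
- rewrite setIC; apply/fin_measurable_fin_num/(fin_measurableIr fA) => //.
Qed.

End finite_measure.

(** * Step functions represented by lists, and their integrals *)

Section simple_functions.
Context {R : realType} {G : pointedMetricType R}.
Variable mu : {measure set (borel G) -> \bar R}.
Context {Y : dvlatticeType R}.
Implicit Types (s : seq (Y * set (borel G))) (A B : set (borel G)).
Implicit Types f h : G -> Y.

Fixpoint step_wf s : Prop :=
  if s is p :: s' then fin_measurable mu p.2 /\ step_wf s' else True.

Definition step_fun s (g : G) : Y := \sum_(p <- s) (\1_(p.2) g : R) *: p.1.

Definition step_int s A : Y := \sum_(p <- s) fine (mu (A `&` p.2)) *: p.1.

Lemma step_wf_cat s1 s2 : step_wf s1 -> step_wf s2 -> step_wf (s1 ++ s2).
Proof. by elim: s1 => //= p s IH [? ?] ?; split=> //; exact: IH. Qed.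

Lemma step_wf_nth s x0 i : step_wf s -> (i < size s)%N ->
  fin_measurable mu (nth x0 s i).2.
Proof. by elim: s i => //= p s IH [|i] [? ?] //=; rewrite ltnS; exact: IH. Qed.

Lemma step_fun_cons p s g :
  step_fun (p :: s) g = (\1_(p.2) g : R) *: p.1 + step_fun s g.
Proof. by rewrite /step_fun big_cons. Qed.

Lemma step_int_cons p s A :
  step_int (p :: s) A = fine (mu (A `&` p.2)) *: p.1 + step_int s A.
Proof. by rewrite /step_int big_cons. Qed.

Lemma step_fun_cat s1 s2 g :
  step_fun (s1 ++ s2) g = step_fun s1 g + step_fun s2 g.
Proof. by rewrite /step_fun big_cat. Qed.

Lemma step_int_cat s1 s2 A :
  step_int (s1 ++ s2) A = step_int s1 A + step_int s2 A.
Proof. by rewrite /step_int big_cat. Qed.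

Lemma step_wf_map s (F : Y -> Y) : step_wf s ->
  step_wf [seq (F p.1, p.2) | p <- s].
Proof. by elim: s => //= p s IH [? ?]; split=> //; exact: IH. Qed.

Lemma step_wf_restrict s B : measurable B -> step_wf s ->
  step_wf [seq (p.1, B `&` p.2) | p <- s].
Proof.
move=> mB; elim: s => //= p s IH [? ?]; split; last exact: IH.
exact: fin_measurableIr.
Qed.

Lemma step_fun_opp s g :
  step_fun [seq (- p.1, p.2) | p <- s] g = - step_fun s g.
Proof.
by rewrite /step_fun big_map -sumrN; apply: eq_bigr => p _; rewrite scalerN.
Qed.

Lemma step_int_opp s A :
  step_int [seq (- p.1, p.2) | p <- s] A = - step_int s A.
Proof.
by rewrite /step_int big_map -sumrN; apply: eq_bigr => p _; rewrite scalerN.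
Qed.

Lemma step_fun_restrict s B g :
  step_fun [seq (p.1, B `&` p.2) | p <- s] g = (\1_B g : R) *: step_fun s g.
Proof.
rewrite /step_fun big_map scaler_sumr; apply: eq_bigr => p _ /=.
by rewrite indicI scalerA.
Qed.

Lemma step_int_restrict s B A :
  step_int [seq (p.1, B `&` p.2) | p <- s] A = step_int s (A `&` B).
Proof.
by rewrite /step_int big_map; apply: eq_bigr => p _ /=; rewrite setIA.
Qed.

Lemma step_int_split s A B : step_wf s -> measurable A -> measurable B ->
  step_int s A = step_int s (A `&` B) + step_int s (A `\` B).
Proof.
move=> + mA mB; elim: s => [|p s IH] /=.
  by rewrite /step_int !big_nil addr0.
move=> [fp fs]; rewrite !step_int_cons (IH fs) addrACA -scalerDl.
congr (_ *: _ + _); rewrite (fine_muID (fin_measurableIr fp mA) mB).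
by rewrite !setDE (setIAC A _ B) (setIAC A _ (~` B)).
Qed.

(* The constant [d] carries the part of the representation already processed:
   splitting [A] along the next set turns [d] into [d + c] on one piece. *)
Lemma step_int_ge0_aux s d A : step_wf s -> measurable A ->
  (mu A < +oo)%E \/ d = 0 -> (forall g, A g -> 0 <= d + step_fun s g) ->
  0 <= fine (mu A) *: d + step_int s A.
Proof.
elim: s d A => [|[c B] s IH] d A /=.
  move=> _ mA _ dge0; rewrite /step_int big_nil addr0.
  have [->|/set0P[g Ag]] := eqVneq A set0; first by rewrite measure0 scale0r.
  apply: scalev_ge0; first exact: fine_mu_ge0.
  by have := dge0 _ Ag; rewrite /step_fun big_nil addr0.
move=> [fB fs] mA Ad dge0; have mB := fB.1.
have fAB := fin_measurableIr fB mA.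
have mAB := fAB.1; have mADB : measurable (A `\` B) by exact: measurableD.
have h1 : 0 <= fine (mu (A `&` B)) *: (d + c) + step_int s (A `&` B).
  apply: IH => //; first by left; exact: fAB.2.
  move=> g [Ag Bg]; have := dge0 _ Ag.
  by rewrite step_fun_cons/= indicE mem_set// scale1r addrA.
have h2 : 0 <= fine (mu (A `\` B)) *: d + step_int s (A `\` B).
  apply: IH => //.
    case: Ad => [Aoo|->]; [left|by right].
    by have [] := fin_measurableW (conj mA Aoo) mADB (@subDsetl _ A B).
  move=> g [Ag Bg]; have := dge0 _ Ag.
  by rewrite step_fun_cons/= indicE memNset// scale0r add0r.
apply: le_trans (addv_ge0 h1 h2) _.
rewrite step_int_cons/= (step_int_split fs mA mB) scalerDr.
have -> : fine (mu A) *: d =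
    fine (mu (A `&` B)) *: d + fine (mu (A `\` B)) *: d.
  case: Ad => [Aoo|->]; last by rewrite !scaler0 addr0.
  by rewrite -scalerDl -fine_muID.
by rewrite [leRHS]addrA addrACA (addrAC _ _ (fine (mu (A `\` B)) *: d)).
Qed.

Lemma step_int_ge0 s A : step_wf s -> measurable A ->
  (forall g, A g -> 0 <= step_fun s g) -> 0 <= step_int s A.
Proof.
move=> fs mA sge0; have := @step_int_ge0_aux s 0 A fs mA (or_intror erefl).
by rewrite scaler0 add0r; apply=> g Ag; rewrite add0r; exact: sge0.
Qed.

(** This makes the integral well defined: one list followed by the opposite of the other represents
    [0], and positivity applies to both differences. *)
Lemma step_int_eq s1 s2 A : step_wf s1 -> step_wf s2 -> measurable A ->
  step_fun s1 =1 step_fun s2 -> step_int s1 A = step_int s2 A.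
Proof.
move=> f1 f2 mA e.
have key s s' : step_wf s -> step_wf s' -> step_fun s =1 step_fun s' ->
    step_int s A <= step_int s' A.
  move=> fs fs' ss'; rewrite -subv_ge0 -step_int_opp -step_int_cat.
  apply: step_int_ge0 => //; first by apply/step_wf_cat/step_wf_map.
  by move=> g _; rewrite step_fun_cat step_fun_opp ss' subrr.
by apply/le_anti; rewrite !key.
Qed.

Lemma simpleP f : is_simple mu f <-> exists2 s, step_wf s & f =1 step_fun s.
Proof.
split=> [[r [c [B [fB fE]]]]|[s fs fE]].
  exists [seq (c j, B j) | j <- enum 'I_r]; last first.
    by move=> g; rewrite fE /step_fun big_map big_enum.
  by elim: (enum _) => //= j js IH; split.
exists (size s), (fun j => (nth (0, set0) s j).1),
  (fun j => (nth (0, set0) s j).2); split=> [j|g]; first exact: step_wf_nth.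
by rewrite fE /step_fun (big_nth (0, set0)) big_mkord.
Qed.

(** [simple_integral] picks the value of some representation of [f]; by [step_int_eq] all
    representations give the same one. *)
Lemma simple_integralE f s A : measurable A -> step_wf s ->
  f =1 step_fun s -> simple_integral mu f A = step_int s A.
Proof.
move=> mA fs fE; rewrite /simple_integral; case: xgetP => [v -> | h]; last first.
  exfalso; apply: (h (step_int s A)).
  exists (size s), (fun j => (nth (0, set0) s j).1),
    (fun j => (nth (0, set0) s j).2); split.
    split=> [j|g]; first exact: step_wf_nth.
    by rewrite fE /step_fun (big_nth (0, set0)) big_mkord.
  by rewrite /step_int (big_nth (0, set0)) big_mkord.
move=> [r [c [B [[fB fE'] ->]]]].
pose s' := [seq (c j, B j) | j <- enum 'I_r].
have -> : \sum_(j < r) fine (mu (A `&` B j)) *: c j = step_int s' A.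
  by rewrite /step_int big_map big_enum.
apply: step_int_eq => // [|g].
  by rewrite /s'; elim: (enum _) => //= j js IH; split.
by rewrite -fE fE' /step_fun big_map big_enum.
Qed.

Lemma simpleD f h : is_simple mu f -> is_simple mu h ->
  is_simple mu (fun g => f g + h g).
Proof.
move=> /simpleP[s fs fE] /simpleP[t ft hE]; apply/simpleP.
by exists (s ++ t); [exact: step_wf_cat|move=> g; rewrite step_fun_cat fE hE].
Qed.

Lemma simpleN f : is_simple mu f -> is_simple mu (fun g => - f g).
Proof.
move=> /simpleP[s fs fE]; apply/simpleP; exists [seq (- p.1, p.2) | p <- s].
  exact: step_wf_map.
by move=> g; rewrite step_fun_opp fE.
Qed.

Lemma simpleB f h : is_simple mu f -> is_simple mu h ->
  is_simple mu (fun g => f g - h g).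
Proof. by move=> sf /simpleN; exact: simpleD. Qed.

Lemma simple_restrict f B : measurable B -> is_simple mu f ->
  is_simple mu (fun g => (\1_B g : R) *: f g).
Proof.
move=> mB /simpleP[s fs fE]; apply/simpleP.
exists [seq (p.1, B `&` p.2) | p <- s]; first exact: step_wf_restrict.
by move=> g; rewrite step_fun_restrict fE.
Qed.

Lemma simple_cst B (c : Y) : fin_measurable mu B ->
  is_simple mu (fun g => (\1_B g : R) *: c).
Proof.
move=> fB; apply/simpleP; exists [:: (c, B)] => // g.
by rewrite step_fun_cons /step_fun big_nil addr0.
Qed.

(** The induction splits [A] along the first set, turning [d] into [d + c] on one piece. What lies
    outside all sets carries the value [F d], which has to vanish if [A] has infinite measure. *)
Lemma step_fun_comp (F : Y -> Y) s d A : step_wf s -> measurable A ->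
  (mu A < +oo)%E \/ F d = 0 -> exists2 s', step_wf s'
    & forall g, step_fun s' g = (\1_A g : R) *: F (d + step_fun s g).
Proof.
elim: s d A => [|[c B] s IH] d A /= fs mA Ad.
  case: Ad => [Aoo|F0].
    exists [:: (F d, A)] => // g.
    by rewrite step_fun_cons /step_fun !big_nil !addr0.
  by exists [::] => // g; rewrite /step_fun !big_nil addr0 F0 scaler0.
case: fs => fB fs; have mB := fB.1; have fAB := fin_measurableIr fB mA.
have [s1 f1 e1] := IH (d + c) (A `&` B) fs fAB.1 (or_introl fAB.2).
have [|s2 f2 e2] := IH d (A `\` B) fs (measurableD mA mB).
  case: Ad => [Aoo|->]; [left|by right].
  have mADB : measurable (A `\` B) by exact: measurableD.
  by have [] := fin_measurableW (conj mA Aoo) mADB (@subDsetl _ A B).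
exists (s1 ++ s2); first exact: step_wf_cat.
move=> g; rewrite step_fun_cat e1 e2 step_fun_cons/= !indicE in_setI in_setD.
by case: (g \in A); case: (g \in B) => /=;
  rewrite ?(scale1r,scale0r,add0r,addr0) ?addrA.
Qed.

Lemma simple_comp (F : Y -> Y) f : F 0 = 0 -> is_simple mu f ->
  is_simple mu (fun g => F (f g)).
Proof.
move=> F0 /simpleP[s fs fE]; apply/simpleP.
have [s' fs' s'E] := @step_fun_comp F s 0 setT fs measurableT (or_intror F0).
by exists s' => // g; rewrite s'E indicT scale1r add0r fE.
Qed.

Lemma simple_vabs f : is_simple mu f -> is_simple mu (fun g => vabs (f g)).
Proof. by apply: simple_comp; rewrite vabs0. Qed.

Lemma simple_integralD f h A : measurable A -> is_simple mu f ->
  is_simple mu h -> simple_integral mu (fun g => f g + h g) A =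
    simple_integral mu f A + simple_integral mu h A.
Proof.
move=> mA /simpleP[s fs fE] /simpleP[t ft hE].
rewrite (simple_integralE mA fs fE) (simple_integralE mA ft hE) -step_int_cat.
apply: simple_integralE => //; first exact: step_wf_cat.
by move=> g; rewrite step_fun_cat fE hE.
Qed.

Lemma simple_integralN f A : measurable A -> is_simple mu f ->
  simple_integral mu (fun g => - f g) A = - simple_integral mu f A.
Proof.
move=> mA /simpleP[s fs fE]; rewrite (simple_integralE mA fs fE) -step_int_opp.
apply: simple_integralE => //; first exact: step_wf_map.
by move=> g; rewrite step_fun_opp fE.
Qed.

Lemma simple_integralB f h A : measurable A -> is_simple mu f ->
  is_simple mu h -> simple_integral mu (fun g => f g - h g) A =
    simple_integral mu f A - simple_integral mu h A.
Proof.
by move=> mA sf sh; rewrite simple_integralD ?simple_integralN//; exact: simpleN.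
Qed.

Lemma simple_integral_ge0 f A : measurable A -> is_simple mu f ->
  (forall g, A g -> 0 <= f g) -> 0 <= simple_integral mu f A.
Proof.
move=> mA /simpleP[s fs fE] f0; rewrite (simple_integralE mA fs fE).
by apply: step_int_ge0 => // g Ag; rewrite -fE; exact: f0.
Qed.

Lemma simple_integral_le f h A : measurable A -> is_simple mu f ->
  is_simple mu h -> (forall g, A g -> f g <= h g) ->
  simple_integral mu f A <= simple_integral mu h A.
Proof.
move=> mA sf sh fh; rewrite -subv_ge0 -simple_integralB//.
apply: simple_integral_ge0 => //; first exact: simpleB.
by move=> g Ag; rewrite subv_ge0; exact: fh.
Qed.

Lemma simple_integral_restrict f A B : measurable A -> measurable B ->
  is_simple mu f ->
  simple_integral mu (fun g => (\1_B g : R) *: f g) A =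
  simple_integral mu f (A `&` B).
Proof.
move=> mA mB /simpleP[s fs fE].
rewrite (simple_integralE (measurableI _ _ mA mB) fs fE) -step_int_restrict.
apply: simple_integralE => //; first exact: step_wf_restrict.
by move=> g; rewrite step_fun_restrict fE.
Qed.

Lemma simple_integral_split f A B : measurable A -> measurable B ->
  is_simple mu f -> simple_integral mu f A =
    simple_integral mu f (A `&` B) + simple_integral mu f (A `\` B).
Proof.
move=> mA mB /simpleP[s fs fE]; rewrite (simple_integralE mA fs fE).
rewrite (step_int_split fs mA mB).
by rewrite !(@simple_integralE f s)//; [exact: measurableD|exact: measurableI].
Qed.

Lemma simple_integral_le_cst f A (c : Y) : fin_measurable mu A ->
  is_simple mu f -> (forall g, A g -> f g <= c) ->
  simple_integral mu f A <= fine (mu A) *: c.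
Proof.
move=> fA sf fc; have sc := simple_cst c fA.
have -> : fine (mu A) *: c = simple_integral mu (fun g => (\1_A g : R) *: c) A.
  rewrite (@simple_integralE _ [:: (c, A)]).
  - by rewrite step_int_cons /step_int big_nil addr0 /= setIid.
  - exact: fA.1.
  - by [].
  - by move=> g; rewrite step_fun_cons /step_fun big_nil addr0.
apply: simple_integral_le => //; first exact: fA.1.
by move=> g Ag; rewrite indicE mem_set// scale1r; exact: fc.
Qed.

Lemma simple_integral_subset f A B : measurable A -> measurable B ->
  A `<=` B -> is_simple mu f -> (forall g, 0 <= f g) ->
  simple_integral mu f A <= simple_integral mu f B.
Proof.
move=> mA mB AB sf f0; rewrite (simple_integral_split mB mA sf) setIC setIidl//.
rewrite -[leLHS]addr0; apply: lev_add2l; apply: simple_integral_ge0 => //.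
exact: measurableD.
Qed.

(* [A] splits into [A `&` B `&` E], [(A `&` B) `\` E] and [A `\` B]; on the
   middle piece the function is at most [c]. *)
Lemma simple_integral_le_split f A B E (c : Y) : measurable A ->
  fin_measurable mu B -> measurable E -> is_simple mu f ->
  (forall g, 0 <= f g) -> 0 <= c -> (forall g, (B `\` E) g -> f g <= c) ->
  simple_integral mu f A <= simple_integral mu f (~` B) +
    (simple_integral mu f (B `&` E) + fine (mu B) *: c).
Proof.
move=> mA fB mE sf f0 c0 fc; have mB := fB.1.
have mBE : measurable (B `\` E) by exact: measurableD.
apply: le_trans (simple_integral_subset mA measurableT _ sf f0) _ => //.
rewrite (simple_integral_split measurableT mB sf) setTI setTD addrC.
apply: lev_add2l; rewrite (simple_integral_split mB mE sf).
apply: lev_add2l; apply: (@le_trans _ _ (fine (mu (B `\` E)) *: c)).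
  apply: simple_integral_le_cst => //.
  exact: fin_measurableW fB mBE (@subDsetl _ B E).
by apply: lev_wscale2r => //; exact: fine_mu_le fB mBE (@subDsetl _ B E).
Qed.

End simple_functions.

(** The majorants of the kernels are real functions times a fixed vector; at the level of simple
    functions their integrals reduce to real ones. *)
Lemma simple_scale (R : realType) (G : pointedMetricType R)
    (mu : {measure set (borel G) -> \bar R}) (Y : dvlatticeType R)
    (r : G -> R^o) (w : Y) : is_simple mu r ->
  is_simple mu (fun g => (r g : R) *: w) /\
  forall A, measurable A -> simple_integral mu (fun g => (r g : R) *: w) A =
    (simple_integral mu r A : R) *: w.
Proof.
move=> /simpleP[s fs rE].
pose s' := [seq ((p.1 : R) *: w, p.2) | p <- s].
have fs' : step_wf mu s' by rewrite /s'; elim: s fs {rE s'} => //= p s IH [? /IH].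
have rE' : (fun g => (r g : R) *: w) =1 step_fun s'.
  move=> g; rewrite rE /step_fun big_map scaler_suml.
  by apply: eq_bigr => p _; rewrite scalerA.
split; first by apply/simpleP; exists s'.
move=> A mA; rewrite (simple_integralE mA fs' rE') (simple_integralE mA fs rE).
rewrite /step_int big_map scaler_suml.
by apply: eq_bigr => p _; rewrite scalerA.
Qed.

(** * The integral *)

Section integral.
Context {R : realType} {G : pointedMetricType R}.
Variables (mu : {measure set (borel G) -> \bar R}) (ellR : convergence R^o).

Lemma cv_mu0U (A B : nat -> set (borel G)) :
  (forall n, measurable (A n)) -> (forall n, measurable (B n)) ->
  cv_mu0 mu ellR A -> cv_mu0 mu ellR B -> cv_mu0 mu ellR (fun n => A n `|` B n).
Proof.
move=> mA mB [Aoo A0] [Boo B0].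
have fA n := conj (mA n) (Aoo n) : fin_measurable mu (A n).
have fB n := conj (mB n) (Boo n) : fin_measurable mu (B n).
split; first by move=> n; have [] := fin_measurableU (fA n) (fB n).
have h := cvD A0 B0; rewrite addr0 in h.
apply: cv_squeeze0 h => n; first exact: fine_mu_ge0.
exact: fine_muU_le.
Qed.

Context {Y : dvlatticeType R}.
Variable ellY : convergence Y.
Implicit Types (fs hs ks : nat -> G -> Y) (f h k : G -> Y) (a b : Y).
Implicit Types A : set (borel G).

(** Suprema are traded for a dominating null sequence, which is easier to add and compare. *)
Lemma cv_in_measureP fs f A : cv_in_measure mu ellR ellY fs f A <->
  exists (An : nat -> set (borel G)) (y : nat -> Y),
  [/\ forall n, measurable (An n), cv_mu0 mu ellR (fun n => A `&` An n),
      forall n, 0 <= y n, cv ellY y 0 &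
      forall n g, A g -> ~ An n g -> vabs (fs n g - f g) <= y n].
Proof.
split=> [[An [mAn An0 /cv_sup_dom[y [y0 yc yub]]]]|[An [y [mAn An0 y0 yc yub]]]].
  exists An, y; split => // n g Ag nAn; apply: yub.
  by exists g.
exists An; split=> //; apply: (dom_cv_sup y0 yc) => n u [g [Ag nAn] <-].
  exact: vabs_ge0.
exact: yub.
Qed.

Lemma cv_in_measure_le2 fs f ks k hs h A : fin_measurable mu A ->
  (forall n g,
    vabs (hs n g - h g) <= vabs (fs n g - f g) + vabs (ks n g - k g)) ->
  cv_in_measure mu ellR ellY fs f A -> cv_in_measure mu ellR ellY ks k A ->
  cv_in_measure mu ellR ellY hs h A.
Proof.
move=> [mA _] hfk /cv_in_measureP[A1 [y1 [mA1 A10 y10 y1c y1u]]].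
move=> /cv_in_measureP[A2 [y2 [mA2 A20 y20 y2c y2u]]]; apply/cv_in_measureP.
exists (fun n => A1 n `|` A2 n), (fun n => y1 n + y2 n); split.
- by move=> n; exact: measurableU.
- have := cv_mu0U (fun n => measurableI _ _ mA (mA1 n))
    (fun n => measurableI _ _ mA (mA2 n)) A10 A20.
  by under eq_fun do rewrite -setIUr.
- by move=> n; exact: addv_ge0.
- by rewrite -[0]addr0; exact: cvD.
- move=> n g Ag /not_orP[n1 n2]; apply: le_trans (hfk n g) _.
  by apply: lev_add; [exact: y1u|exact: y2u].
Qed.

(** The closure property behind sums, opposites, restrictions and positive parts. Exceptional sets
    and exhausting sets are united, and the bounds are added. *)
Lemma defining_le2 fs f ks k hs h : (forall n, is_simple mu (hs n)) ->
  (forall n g,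
    vabs (hs n g - h g) <= vabs (fs n g - f g) + vabs (ks n g - k g)) ->
  (forall n g, vabs (hs n g) <= vabs (fs n g) + vabs (ks n g)) ->
  defining mu ellR ellY fs f -> defining mu ellR ellY ks k ->
  defining mu ellR ellY hs h.
Proof.
move=> shs dhs ahs [sfs dfs [f1 [B1 [fB1 iB1 [y1 [y1s y1c]]]]]].
move=> [sks dks [k1 [B2 [fB2 iB2 [y2 [y2s y2c]]]]]].
have le2 n A : measurable A -> simple_integral mu (fun g => vabs (hs n g)) A <=
    simple_integral mu (fun g => vabs (fs n g)) A +
    simple_integral mu (fun g => vabs (ks n g)) A.
  move=> mA; rewrite -simple_integralD//; [|exact: simple_vabs..].
  apply: simple_integral_le => //; first exact: simple_vabs.
  by apply: simpleD; exact: simple_vabs.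
have si_ge0 us n A : is_simple mu (us n) -> measurable A ->
    0 <= simple_integral mu (fun g => vabs (us n g : Y)) A.
  move=> su mA; apply: simple_integral_ge0 => //; first exact: simple_vabs.
  by move=> g _; exact: vabs_ge0.
split=> //; first by move=> A fA; apply: cv_in_measure_le2 dhs _ _ => //; auto.
split=> [An mAn An0|].
  have := cvD (f1 _ mAn An0) (k1 _ mAn An0); rewrite addr0.
  by apply: cv_squeeze0 => n; [exact: si_ge0|exact: le2].
exists (fun m => B1 m `|` B2 m); split.
- by move=> m; exact: fin_measurableU.
- by move=> m; exact: setUSS.
have mB1 m := (fB1 m).1; have mB2 m := (fB2 m).1.
have mBC m : measurable (~` (B1 m `|` B2 m)).
  by apply: measurableC; exact: measurableU.
(* The limit superior might be infinite; subadditivity bounds it by [y1 m + y2 m], and [choice]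
   collects its finite values into a sequence. *)
have : forall m, exists y, [/\ climsup ellY (fun n =>
    simple_integral mu (fun g => vabs (hs n g)) (~` (B1 m `|` B2 m))) = Fin y,
    0 <= y & y <= y1 m + y2 m].
  move=> m; apply: climsup_fin; first by move=> n; exact: si_ge0.
  pose u n := simple_integral mu (fun g => vabs (fs n g)) (~` B1 m).
  pose v n := simple_integral mu (fun g => vabs (ks n g)) (~` B2 m).
  have u0 n : 0 <= u n by apply: si_ge0 => //; exact: measurableC.
  have v0 n : 0 <= v n by apply: si_ge0 => //; exact: measurableC.
  pose w n := simple_integral mu (fun g => vabs (hs n g)) (~` (B1 m `|` B2 m)).
  have w0 n : 0 <= w n by exact: si_ge0.
  have wuv n : w n <= u n + v n.
    apply: le_trans (le2 _ _ (mBC m)) _; rewrite setCU.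
    apply: lev_add; apply: simple_integral_subset => //;
      do ?[exact: simple_vabs | exact: vabs_ge0 | exact: measurableC
         | by rewrite -setCU | by move=> g; exact: vabs_ge0 | by move=> g []].
  have uv0 n := addv_ge0 (u0 n) (v0 n).
  have : ext_le (climsup ellY w) (climsup ellY (fun n => u n + v n)).
    by apply: climsup_le => //; exact: nearW.
  have := climsupD ellY u0 v0; rewrite y1s y2s /=.
  case: (climsup ellY (fun n => u n + v n)) => //= d dy.
  by rewrite -/w; case: (climsup ellY w) => //= e; move/le_trans; apply.
move=> /choice[y yP]; exists y; split; first by move=> m; have [] := yP m.
have := cvD y1c y2c; rewrite addr0.
by apply: cv_squeeze0 => m; have [] := yP m.
Qed.

(** For fixed [m] the integral is at most the tail outside [B m], plus the part over the exceptional
    set, plus [mu (B m)] times [z n]. The last two tend to [0] in [n], so the limit superior is at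
    most [y m], and [y] is null. *)
Lemma cv_simple_integral0 hs : defining mu ellR ellY hs (fun=> 0) ->
  (forall n g, 0 <= hs n g) ->
  cv ellY (fun n => simple_integral mu (hs n) setT) 0.
Proof.
move=> [shs dhs [ei [B [fB iB [y [yE yc]]]]]] h0.
have absE n : (fun g => vabs (hs n g)) = hs n.
  by apply/funext => g; exact: ger0_vabs.
have int_ge0 n A : measurable A -> 0 <= simple_integral mu (hs n) A.
  by move=> mA; exact: simple_integral_ge0.
apply: (climsup_cv0 _ yc) => [n|m]; first exact: int_ge0.
have /cv_in_measureP[An [z [mAn An0 z0 zc zu]]] := dhs _ (fB m).
have mBA n : measurable (B m `&` An n) by apply: measurableI => //; case: (fB m).
have mBC : measurable (~` B m) by apply: measurableC; case: (fB m).
apply: (@climsup_le_cv0 _ _ _ _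
    (fun n => simple_integral mu (hs n) (~` B m))
    (fun n => simple_integral mu (hs n) (B m `&` An n) + fine (mu (B m)) *: z n)).
- by move=> n; exact: int_ge0.
- by move=> n; exact: int_ge0.
- move=> n; apply: addv_ge0; first exact: int_ge0.
  by apply: scalev_ge0 => //; exact: fine_mu_ge0.
- move=> n; apply: simple_integral_le_split => // g [Bg nAg].
  by have := zu n g Bg nAg; rewrite subr0 ger0_vabs.
- by have := yE m; under eq_fun do rewrite absE; move=> ->; exact: lexx.
- rewrite -[0]addr0; apply: cvD.
    by have := ei _ mBA An0; under eq_fun do rewrite absE.
  by rewrite -(scaler0 _ (fine (mu (B m)))); exact: cvZ.
Qed.

(** Only the total value of the integral is kept, with no set function and no splitting into
    positive and negative parts. Integrals over [A] are recovered by means of the indicator of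
    [A]. *)
Definition has_int f a := exists2 fs, defining mu ellR ellY fs f
  & cv ellY (fun n => simple_integral mu (fs n) setT) a.

Lemma defining_simple fs f : defining mu ellR ellY fs f ->
  forall n, is_simple mu (fs n).
Proof. by case. Qed.

Lemma eq_has_int f h a : f =1 h -> has_int f a -> has_int h a.
Proof. by move=> /funext ->. Qed.

Lemma has_intD f h a b : has_int f a -> has_int h b ->
  has_int (fun g => f g + h g) (a + b).
Proof.
move=> [fs dfs fa] [hs dhs hb].
have sf := defining_simple dfs; have sh := defining_simple dhs.
exists (fun n g => fs n g + hs n g).
  apply: defining_le2 dfs dhs => [n|n g|n g]; first exact: simpleD.
    by rewrite opprD addrACA; exact: vabsD.
  exact: vabsD.
apply: eq_cv (cvD fa hb) => n.
by rewrite simple_integralD.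
Qed.

Lemma has_intN f a : has_int f a -> has_int (fun g => - f g) (- a).
Proof.
move=> [fs dfs fa]; have sf := defining_simple dfs.
exists (fun n g => - fs n g).
  apply: (defining_le2 _ _ _ dfs dfs) => [n|n g|n g]; first exact: simpleN.
    by rewrite -opprD vabsN -[leLHS]addr0 lev_add2l// vabs_ge0.
  by rewrite vabsN -[leLHS]addr0 lev_add2l// vabs_ge0.
by apply: eq_cv (cvN fa) => n; rewrite simple_integralN.
Qed.

Lemma has_intB f h a b : has_int f a -> has_int h b ->
  has_int (fun g => f g - h g) (a - b).
Proof. by move=> fa /has_intN; exact: has_intD. Qed.

(* The positive parts of [fs n - hs n] are at most
   [|fs n - f| + |hs n - h|], hence a defining sequence for [0]. *)
Lemma has_int_le f h a b : has_int f a -> has_int h b ->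
  (forall g, f g <= h g) -> a <= b.
Proof.
move=> [fs dfs fa] [hs dhs hb] fh.
have sf := defining_simple dfs; have sh := defining_simple dhs.
pose ps n g := vpos (fs n g - hs n g).
have sps n : is_simple mu (ps n).
  apply: (@simple_comp _ _ _ _ (@vpos R Y)); last exact: simpleB.
  exact: vjoin_idl.
have ps0 n g : 0 <= ps n g by exact: vpos_ge0.
have dps : defining mu ellR ellY ps (fun=> 0).
  apply: defining_le2 dfs dhs => // n g; rewrite ?subr0 (ger0_vabs (ps0 n g)).
    apply: vpos_le; last by apply: addv_ge0; exact: vabs_ge0.
    apply: (@le_trans _ _ (fs n g - f g + (h g - hs n g))).
      rewrite addrA; apply: lev_add2r; rewrite -addrA -[leLHS]addr0.
      by apply: lev_add2l; rewrite addrC subv_ge0.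
    by apply: lev_add; [exact: le_vabs|rewrite vdistC; exact: le_vabs].
  apply: vpos_le; last by apply: addv_ge0; exact: vabs_ge0.
  exact: le_trans (le_vabs _) (vabsB _ _).
have := cv_simple_integral0 dps ps0.
rewrite -subv_le0; apply: cv_le (cvB fa hb) => n.
rewrite -simple_integralB//; apply: simple_integral_le => //.
  exact: simpleB.
by move=> g _; exact: le_vpos.
Qed.

Lemma has_int_uniq f a b : has_int f a -> has_int f b -> a = b.
Proof.
move=> fa fb; apply/le_anti.
by rewrite (has_int_le fa fb)//= (has_int_le fb fa).
Qed.

(** Since [0 + 0 = 0], uniqueness gives [a + a = a]. *)
Lemma has_int_zero a : has_int (fun=> 0) a -> a = 0.
Proof.
move=> h; have := has_intD h h; rewrite addr0 => /has_int_uniq/(_ h) e.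
by apply: (addrI a); rewrite addr0.
Qed.

(** The restrictions of [fs] to [A] are defining for the restriction of [f]. Their total integrals
    are those of [fs n] over [A], which the estimate uniform in the measurable sets compares with
    [l A]. *)
Lemma pos_integral_has_int f l A : measurable A ->
  is_pos_integral mu ellR ellY f l ->
  has_int (fun g => (\1_A g : R) *: f g) (l A).
Proof.
move=> mA [fs [dfs fl]]; have sf := defining_simple dfs.
have ind_le g (x : Y) : 0 <= x -> (\1_A g : R) *: x <= x.
  by move=> x0; rewrite -[leRHS]scale1r; apply: lev_wscale2r.
exists (fun n g => (\1_A g : R) *: fs n g).
  apply: (defining_le2 _ _ _ dfs dfs) => [n|n g|n g].
  - exact: simple_restrict.
  - rewrite -scalerBr vabsZ_ge0// -[leLHS]addr0.
    by apply: lev_add; [apply: ind_le|]; exact: vabs_ge0.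
  - rewrite vabsZ_ge0// -[leLHS]addr0.
    by apply: lev_add; [apply: ind_le|]; exact: vabs_ge0.
have /cv_sup_dom[y [y0 yc yub]] := fl.
apply: cv_dist yc => n; rewrite simple_integral_restrict// setTI.
by apply: yub; exists A.
Qed.

(** The chosen set function and [l] both give at [A] the integral of the restriction of [f] to [A],
    which is unique. *)
Lemma pos_integralE f l A : measurable A -> is_pos_integral mu ellR ellY f l ->
  pos_integral mu ellR ellY f A = l A.
Proof.
move=> mA fl; rewrite /pos_integral; case: xgetP => [_ -> [l' [fl' ->]]|h].
  by apply: (has_int_uniq (f := fun g => (\1_A g : R) *: f g));
    exact: pos_integral_has_int.
by exfalso; apply: (h (l A)); exists l.
Qed.

Lemma vintegral_has_int f A : measurable A -> vintegrable mu ellR ellY f ->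
  has_int (fun g => (\1_A g : R) *: f g) (vintegral mu ellR ellY A f).
Proof.
move=> mA [[l1 fl1] [l2 fl2]].
rewrite /vintegral (pos_integralE mA fl1) (pos_integralE mA fl2).
have := has_intB (pos_integral_has_int mA fl1) (pos_integral_has_int mA fl2).
by apply: eq_has_int => g; rewrite -scalerBr vposB_vneg.
Qed.

Lemma vintegral_has_intT f : vintegrable mu ellR ellY f ->
  has_int f (vintegral mu ellR ellY setT f).
Proof.
move=> /(vintegral_has_int measurableT); apply: eq_has_int => g.
by rewrite indicT scale1r.
Qed.

End integral.

(** A defining sequence for [r] is multiplied by [w]: [pt_cvl] transports the null sequences, and
    [pt_limsupl] the limits superior of the tails outside [B m]. *)
Lemma has_int_scale (R : realType) (G : pointedMetricType R)
    (mu : {measure set (borel G) -> \bar R}) (Y : dvlatticeType R)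
    (ellR : convergence R^o) (ell : convergence Y) (r : G -> R^o) (a : R^o)
    (w : Y) :
  product_triple ellR ell ell (fun (r : R) (x : Y) => r *: x) -> 0 <= w ->
  has_int mu ellR ellR r a ->
  has_int mu ellR ell (fun g => (r g : R) *: w) ((a : R) *: w).
Proof.
move=> RYY w0 [rs [srs drs [ei [B [fB iB [y [yE yc]]]]]] ra].
have absE n : (fun g => vabs ((rs n g : R) *: w)) =
    (fun g => (vabs (rs n g) : R) *: w).
  by apply/funext => g; rewrite vabs_scale.
have sint n A : measurable A ->
    simple_integral mu (fun g => vabs ((rs n g : R) *: w)) A =
    (simple_integral mu (fun g => vabs (rs n g)) A : R) *: w.
  move=> mA; rewrite absE; apply: (simple_scale w _).2 => //.
  exact: simple_vabs.
exists (fun n g => (rs n g : R) *: w); last first.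
  have /(pt_cvl RYY)-/(_ w) :
      cv ellR (fun n => simple_integral mu (rs n) setT - a) 0.
    by rewrite -(subrr a); apply: cvB => //; exact: cv_cst.
  move=> h; apply: cvB0; apply: eq_cv h => n.
  by rewrite scalerBl (simple_scale w (srs n)).2.
split.
- by move=> n; exact: (simple_scale w (srs n)).1.
- move=> A fA; have /cv_in_measureP[An [z [mAn An0 z0 zc zu]]] := drs _ fA.
  apply/cv_in_measureP; exists An, (fun n => (z n : R) *: w); split=> //.
  + by move=> n; exact: scalev_ge0.
  + exact: (pt_cvl RYY).
  + move=> n g Ag nAg; rewrite -scalerBl vabs_scale//.
    by apply: lev_wscale2r => //; exact: zu.
- split=> [An mAn An0|].
    apply: eq_cv (pt_cvl RYY w (ei _ mAn An0)) => n.
    by rewrite sint.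
  exists B; split=> //; exists (fun m => (y m : R) *: w); split; last first.
    exact: (pt_cvl RYY).
  move=> m; have mBC : measurable (~` B m) by apply: measurableC; case: (fB m).
  under eq_fun do rewrite sint//.
  apply: (pt_limsupl RYY _ w0 (yE m)) => n.
  apply: simple_integral_ge0 => //; first exact: simple_vabs.
  by move=> g _; exact: vabs_ge0.
Qed.

(** * Singular kernels *)

Section metric.
Context {R : realType} {G : pointedMetricType R}.

(** The complement is open: it contains, with [t], the ball of radius [mdist s t - delta] around
    [t]. *)
Lemma measurable_setC_cball (s : G) (delta : R) :
  measurable (~` cball s delta : set (borel G)).
Proof.
apply: sub_sigma_algebra; rewrite openE => t /= /negP; rewrite -ltNge => dt.
rewrite /interior; apply/nbhs_ballP; exists (mdist s t - delta) => /=.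
  by rewrite subr_gt0.
move=> t'; rewrite ballEmdist /= => tt'; apply/negP; rewrite -ltNge.
have := metric_triangle s t' t; rewrite (metric_sym t' t) => h.
by rewrite -(ltrD2r (mdist t t')); apply: lt_le_trans h; rewrite -ltrBrDl.
Qed.

(** Finitely many balls cover the support, and on each of them [f] differs from its value at the
    centre by at most [u]. *)
Lemma Cc_bounded (X : dvlatticeType R) (f : G -> X) : Cc f ->
  exists2 v : X, 0 <= v & forall g, vabs (f g) <= v.
Proof.
move=> [[u [u0 /(_ 1 ltr01)[d [d0 fd]]]]].
rewrite compact_cover => /(_ G setT (fun i => (ball i d)^°)) [||D' _ cov].
- by move=> i _; exact: open_interior.
- by move=> g _; exists g => //; exact: nbhsx_ballx.
(* The sum of the moduli at the centres stands in for their finite supremum. *)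
exists (\sum_(i <- finmap.enum_fset D') vabs (f i) + u).
  by apply: addv_ge0 => //; apply: sumv_ge0 => i; exact: vabs_ge0.
move=> g; have [->|fg0] := eqVneq (f g) 0.
  rewrite vabs0; apply: addv_ge0 => //; apply: sumv_ge0 => i; exact: vabs_ge0.
have [i iD /interior_subset] :=
  cov g (@subset_closure _ [set g | f g != 0] g fg0).
rewrite ballEmdist /= => /ltW/fd; rewrite scale1r => ifg.
rewrite (big_rem i iD)/= -addrA.
apply: (@le_trans _ _ (vabs (f i) + vabs (f i - f g))).
  by rewrite -{1}[f g](subKr (f i)); exact: vabsB.
apply: lev_add2l; apply: le_trans ifg _; rewrite -[leLHS]add0r.
by apply: lev_add2r; apply: sumv_ge0 => j; exact: vabs_ge0.
Qed.

End metric.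

(** The support inequality of [phi] at [x n], tested at [0], bounds [phi (x n)] by the product of
    [beta (x n)] and [x n]. As [0 <= x n <= u], the slope is at most [b], and the products of [b]
    and [x n] tend to [0]. *)
Lemma modular_map_cv0 (R : realType) (X : dvlatticeType R)
    (ell : convergence X) (mulX : X -> X -> X) (phi : X -> X)
    (x : nat -> X) (u : X) :
  product_triple ell ell ell mulX -> modular_map mulX phi -> 0 < u ->
  (forall n, 0 <= x n) -> (forall n, x n <= u) -> cv ell x 0 ->
  cv ell (fun n => phi (x n)) 0.
Proof.
move=> XXX phiP u0 x0 xu xc.
have [beta [betaP /(_ u u0)[a [b ab]]]] := phi_convex phiP.
have mulN v t : mulX v (- t) = - mulX v t.
  apply/eqP; rewrite -addr_eq0 -(ptDr XXX) addNr; apply/eqP.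
  by apply: (addrI (mulX v 0)); rewrite -(ptDr XXX) !addr0.
apply: cv_squeeze0 (pt_cvr XXX b xc) => n.
  by rewrite -(phi_0 phiP); exact: phi_incr phiP _ _ _ _.
apply: (@le_trans _ _ (mulX (beta (x n)) (x n))).
  have := betaP (x n) 0; rewrite sub0r mulN (phi_0 phiP).
  by rewrite subv_le0.
apply: (pt_lel XXX) => //; apply: (ab _ _ _).2 => //.
apply: le_trans (x0 n).
by rewrite -oppr0 levN2 ltW.
Qed.

(** * Comparison of the operators with the identity *)

Section estimates.
Context {R : realType} {G : pointedMetricType R} {X : dvlatticeType R}.
Variables (mu : {measure set (borel G) -> \bar R}).
Variables (ellR : convergence R^o) (ell : convergence X).
Hypothesis RXX : product_triple ellR ell ell (fun (r : R) (x : X) => r *: x).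

(** The zero function is obtained as [f - f], with integral [a - a], and compared with [f]. *)
Lemma has_int_ge0 (Y : dvlatticeType R) (ellY : convergence Y) (f : G -> Y) a :
  has_int mu ellR ellY f a -> (forall g, 0 <= f g) -> 0 <= a.
Proof.
move=> fa f0; rewrite -(subrr a).
by apply: (has_int_le (has_intB fa fa) fa) => g; rewrite subrr.
Qed.

Lemma vintegral_ge0_le (A : set (borel G)) (r : G -> R^o) : measurable A ->
  vintegrable mu ellR ellR r -> (forall t, 0 <= r t) ->
  0 <= vintegral mu ellR ellR A r <= vintegral mu ellR ellR setT r.
Proof.
move=> mA ri r0; have rA := vintegral_has_int mA ri.
apply/andP; split.
  by apply: has_int_ge0 rA _ => g; exact: scalev_ge0.
apply: has_int_le rA (vintegral_has_intT ri) _ => g.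
by rewrite -[leRHS]scale1r; apply: lev_wscale2r.
Qed.

(** The sum of [r w] on all of [G] and of [r a] off [B] has the right-hand side as its integral and
    dominates both [h - h'] and [h' - h]. *)
Lemma vintegral_dist (h h' : G -> X) (r : G -> R^o) (B : set (borel G))
    (w a : X) : measurable (~` B) -> 0 <= w -> 0 <= a -> (forall t, 0 <= r t) ->
  vintegrable mu ellR ell h -> vintegrable mu ellR ell h' ->
  vintegrable mu ellR ellR r ->
  (forall t, B t -> vabs (h t - h' t) <= (r t : R) *: w) ->
  (forall t, ~ B t -> vabs (h t - h' t) <= (r t : R) *: a) ->
  vabs (vintegral mu ellR ell setT h - vintegral mu ellR ell setT h') <=
    (vintegral mu ellR ellR setT r : R) *: w +
    (vintegral mu ellR ellR (~` B) r : R) *: a.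
Proof.
move=> mB w0 a0 r0 /vintegral_has_intT hi /vintegral_has_intT h'i ri hB hNB.
have qi := has_intD (has_int_scale RXX w0 (vintegral_has_intT ri))
  (has_int_scale RXX a0 (vintegral_has_int mB ri)).
have le_q t : vabs (h t - h' t) <=
    (r t : R) *: w + ((\1_(~` B) t : R) *: r t : R) *: a.
  have [Bt|nBt] := pselect (B t).
    rewrite -[leLHS]addr0; apply: lev_add; first exact: hB.
    by apply: scalev_ge0 => //; exact: mulr_ge0.
  rewrite -[leLHS]add0r; apply: lev_add; first exact: scalev_ge0.
  by rewrite indicE mem_set// scale1r; exact: hNB.
rewrite vabs_le; apply/andP; split.
  apply: (has_int_le (has_intB hi h'i) qi) => t.
  exact: le_trans (le_vabs _) (le_q t).
rewrite opprD opprK addrC; apply: (has_int_le (has_intB h'i hi) qi) => t.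
by apply: le_trans (le_q t); rewrite vdistC; exact: le_vabs.
Qed.

(** The sets [S n] serve both modes of convergence: they are [A] itself, or [A] without exceptional
    sets. The common upper bound of the [x n] is required for applying [phi]. *)
Lemma operator_dominated (psi : nat -> X -> X) (K : nat -> G -> G -> X -> X)
    (L : nat -> G -> G -> R) (H : set nat) (S : nat -> set (borel G))
    (z : X) (eps : nat -> R^o) (f : G -> X) :
  Xi psi -> K_class mu ellR ell psi K -> singular mu ellR ell psi K L H ->
  (forall delta : R, 0 < delta -> exists y : nat -> R^o,
    [/\ forall n, 0 <= y n, cv ellR y 0 & forall n s, S n s ->
      vintegral mu ellR ellR (~` cball s delta) (L n s) <= y n]) ->
  0 < z -> (forall n, 0 < eps n) -> osequence eps ->
  (forall n s u, H n -> S n s -> u != 0 ->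
    vabs (vintegral mu ellR ell setT (fun t => K n s t u) - u) <=
      (eps n : R) *: z) ->
  Cc f -> operator_dom mu ellR ell K f ->
  exists x : nat -> X, [/\ forall n, 0 <= x n, cv ell x 0,
    exists2 u : X, 0 < u & forall n, x n <= u
  & forall n s, H n -> S n s ->
      vabs (operator mu ellR ell K n f s - f s) <= x n].
Proof.
move=> psiP KP sing tails z0 eps0 oeps approx Ccf domf.
have [v v0 fv] := Cc_bounded Ccf.
have [[u [u0 fuc]] _] := Ccf.
(* The values of [f] differ by at most [v + v], so [a] bounds [psi n] at all these differences. *)
have [a [a0 psia]] := Xi_bounded psiP (addv_ge0 v0 v0).
(* [Xi_equi0] asks for a strictly positive element, whereas [u] may be [0]. *)
have ua0 : 0 < u + a.
  by apply: lt_le_trans a0 _; rewrite -[leLHS]add0r; exact: lev_add2r.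
have [w [w0 psiw]] := Xi_equi0 psiP ua0.
have [D [D0 LD _]] := sing_bound sing.
have L0 n s t : 0 <= L n s t := sk_ge0 (sing_kernel sing n) s t.
have Li n s := sk_integrable2 (sing_kernel sing n) s.
have psi_a n s t : psi n (vabs (f t - f s)) <= a.
  apply: le_trans (psia n); apply: (Psi_incr (Xi_Psi psiP n)).
    exact: vabs_ge0.
  by apply: le_trans (vabsB _ _) _; exact: lev_add.
have mball := @measurable_setC_cball R G.
(* This is applied twice: with [e = 1] and [p = a] for a crude bound, and with small [e] and [p = w]
   for the limit. *)
have dist (n : nat) (s : G) (e : R) (p : X) (delta : R) : H n -> S n s ->
    0 <= p -> 0 <= e ->
    (forall t, cball s delta t -> psi n (vabs (f t - f s)) <= e *: p) ->
    vabs (operator mu ellR ell K n f s - f s) <= e *: (D *: p) +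
     ((vintegral mu ellR ellR (~` cball s delta) (L n s) : R) *: a +
      (eps n : R) *: z).
  move=> Hn Ss p0 e0 psip.
  set I := vintegral mu ellR ell setT (fun t => K n s t (f s)).
  have -> : operator mu ellR ell K n f s - f s =
      (operator mu ellR ell K n f s - I) + (I - f s) by rewrite addrA subrK.
  apply: le_trans (vabsD _ _) _; rewrite addrA; apply: lev_add; last first.
    (* The approximation hypothesis concerns nonzero values only; if [f s = 0], then [I] vanishes
       with the kernel. *)
    have [fs0|] := eqVneq (f s) 0; last exact: approx.
    have -> : I = 0.
      apply: (@has_int_zero R G mu ellR X ell).
      have := vintegral_has_intT (K_integrable2 KP n s (f s)).
      by apply: eq_has_int => t; rewrite fs0 (K_0 KP).
    by rewrite fs0 subrr vabs0; apply: scalev_ge0; exact: ltW.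
  have psi_le t (c : X) : psi n (vabs (f t - f s)) <= c ->
      vabs (K n s t (f t) - K n s t (f s)) <= L n s t *: c.
    by move=> h; apply: le_trans (sing_Lip sing n s t _ _) _; exact: lev_wpscale.
  have := @vintegral_dist (fun t => K n s t (f t)) (fun t => K n s t (f s))
    (L n s) (cball s delta) (e *: p) a (mball s delta) (scalev_ge0 e0 p0) (ltW a0)
    (L0 n s) (domf n s) (K_integrable2 KP n s (f s)) (Li n s)
    (fun t h => psi_le _ _ (psip _ h)) (fun t _ => psi_le _ _ (psi_a n s t)).
  move/le_trans; apply; apply: lev_add2r.
  rewrite [leLHS]scalerA [leRHS]scalerA [_ * e]mulrC.
  by apply: lev_wscale2r => //; apply: ler_wpM2l => //; exact: LD.
pose F n := [set vabs (operator mu ellR ell K n f s - f s) | s in S n].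
(* Off [H] no estimate is claimed, and the bound is set to [0]. *)
pose x n := if n \in H then supremum 0 (F n) else 0.
(* The crude bound from [dist]: the mass off the ball is at most [D], and [eps n] at most
   [eps 0]. *)
pose b := (1 : R) *: (D *: a) + (D *: a + (eps 0%N : R) *: z).
have b0 : 0 < b.
  have Da0 : 0 <= D *: a by apply: scalev_ge0; exact: ltW.
  have epsz : 0 < (eps 0%N : R) *: z.
    rewrite lt_def scaler_eq0 negb_or; apply/andP; split; last first.
      by apply: scalev_ge0; exact: ltW.
    by apply/andP; split; [exact/lt0r_neq0/eps0|
      move: z0; rewrite lt_def => /andP[]].
  apply: lt_le_trans epsz _; rewrite /b scale1r -[leLHS]add0r.
  apply: lev_add => //; rewrite -[leLHS]add0r; exact: lev_add2r.
have Fb n : H n -> ubound (F n) b.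
  move=> Hn _ [s Ss <-]; have := @dist n s 1 a 1 Hn Ss (ltW a0) ler01.
  rewrite scale1r => /(_ (fun t _ => psi_a n s t))/le_trans; apply.
  apply: lev_add2l; apply: lev_add.
    apply: lev_wscale2r; first exact: ltW.
    apply: le_trans (LD s n Hn).
    by have /andP[] := vintegral_ge0_le (mball s 1) (Li n s) (L0 n s).
  by apply: lev_wscale2r; [exact: ltW|exact: (osequence_le oeps (leq0n n))].
have x0 n : 0 <= x n.
  rewrite /x; case: ifP => // _.
  by apply: supremum_ge0 => _ [s _ <-]; exact: vabs_ge0.
have xle n c : 0 <= c -> (H n -> ubound (F n) c) -> x n <= c.
  move=> c0 Fc; rewrite /x; case: ifPn => // /set_mem Hn.
  by apply: supremum_le; auto.
exists x; split => //.
- have c0 : 0 <= D *: w by apply: scalev_ge0; exact: ltW.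
  (* It is enough to bound the limit superior by [D *: w] divided by [m + 1] for each [m]; [delta]
     and [y] may depend on [m], but [w] does not. *)
  apply: (climsup_cv0 x0 (cv_harmonic ell c0)) => m.
  have e0 : 0 < m.+1%:R^-1 :> R by rewrite invr_gt0.
  set e := m.+1%:R^-1 in e0 *.
  have [d [d0 psid]] := psiw e e0.
  have [delta [delta0 fdelta]] := fuc d d0.
  have [y [y0 yc ytail]] := tails delta delta0.
  have eDw : 0 <= e *: (D *: w) by apply: scalev_ge0 => //; exact: ltW.
  have y'0 n : 0 <= (y n : R) *: a + (eps n : R) *: z.
    by apply: addv_ge0; apply: scalev_ge0 => //; exact: ltW.
  apply: (@climsup_le_cv0 _ _ _ _ (fun=> e *: (D *: w))
    (fun n => (y n : R) *: a + (eps n : R) *: z)) => //.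
  + move=> n; apply: xle; first exact: addv_ge0.
    move=> Hn _ [s Ss <-]; apply: le_trans (dist _ _ e w delta Hn Ss _ _ _) _.
    * exact: ltW.
    * exact: ltW.
    (* On the ball the difference of values is at most [d *: u], hence at most [d *: (u + a)]. *)
    * move=> t st; apply: psid; first exact: vabs_ge0.
      rewrite vdistC; apply: le_trans (fdelta _ _ st) _.
      apply: lev_wpscale; first exact: ltW.
      by rewrite -[leLHS]addr0; apply: lev_add2l; exact: ltW.
    * apply: lev_add2l; apply: lev_add2r; apply: lev_wscale2r; first exact: ltW.
      exact: ytail.
  + rewrite (climsup_cv _ (cv_cst ell _))//; exact: lexx.
  + rewrite -[0]addr0; apply: cvD; first exact: (pt_cvl RXX).
    by apply: (pt_cvl RXX); exact: cv_osequence.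
- by exists b => // n; apply: xle; [exact: ltW|exact: Fb].
- move=> n s Hn Ss; rewrite /x mem_set//.
  by apply: le_supremum; [exists b; exact: Fb|exists s].
Qed.

Lemma cv_in_measure_along (H : set nat) (A : set (borel G))
    (E : nat -> set (borel G)) (x : nat -> X) (hs : nat -> G -> X) (h : G -> X) :
  (forall y : nat -> R^o, (forall n, 0 <= y n) ->
    climsup ellR y = climsup ellR (zero_off H y)) ->
  fin_measurable mu A -> (forall n, measurable (E n)) -> cv_mu0 mu ellR E ->
  (forall n, 0 <= x n) -> cv ell x 0 ->
  (forall n s, H n -> (A `\` E n) s -> vabs (hs n s - h s) <= x n) ->
  cv_in_measure mu ellR ell hs h A.
Proof.
move=> Hsup fA mE [Eoo E0] x0 xc hx; apply/cv_in_measureP.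
have mA := fA.1.
(* Off [H] all of [A] is exceptional, which leaves nothing to estimate there; by [Hsup] the measures
   at these indices do not affect the limit. *)
exists (fun n => if n \in H then E n else A), x; split => //.
- by move=> n; case: ifP.
- split=> [n|].
    by case: ifP => _; [have [] := fin_measurableIr fA (mE n); rewrite setIC
                       |rewrite setIid; case: fA].
  apply: (@cv_zero_off _ _ _ H); last first.
  + apply: cv_squeeze0 E0 => n; rewrite /zero_off; case: (n \in H) => //;
      rewrite ?fine_mu_ge0//.
    apply: fine_mu_le; [exact: conj (mE n) (Eoo n)|exact: measurableI|].
    exact: subIsetr.
  + by move=> n; exact: fine_mu_ge0.
  + by apply: Hsup => n; exact: fine_mu_ge0.
- by move=> n s As; case: ifPn => // /set_mem Hn nEs; apply: hx.
Qed.

(** The values that [y] takes off [H] are hidden by [Hsup]; on [H] the suprema exist and are at most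
    [x n]. *)
Lemma cv_uniform_along_dom (H : set nat) (A : set (borel G))
    (x : nat -> X) (hs : nat -> G -> X) (h : G -> X) :
  (forall y : nat -> X, (forall n, 0 <= y n) ->
    climsup ell y = climsup ell (zero_off H y)) ->
  (forall n, 0 <= x n) -> cv ell x 0 ->
  (forall n s, H n -> A s -> vabs (hs n s - h s) <= x n) ->
  cv_uniform_along ell H hs h A.
Proof.
move=> Hsup x0 xc hx.
have ubx n : H n -> ubound [set vabs (hs n g - h g) | g in A] (x n).
  by move=> Hn _ [s As <-]; exact: hx.
split=> [n Hn|y y0 yE]; first by exists (x n); exact: ubx.
apply: (@cv_zero_off _ _ _ H) => //; first exact: Hsup.
apply: cv_squeeze0 xc => n; rewrite /zero_off; case: ifPn => // /set_mem Hn.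
rewrite yE; last by exists (x n); exact: ubx.
exact: supremum_le (x0 n) (ubx n Hn).
Qed.

End estimates.

(** * Convergence of the operators and of their modulars, in measure and uniformly *)

Theorem theorem6p3 (R : realType) (X : dvlatticeType R)
    (G : pointedMetricType R) (mu : {measure set (borel G) -> \bar R})
    (ellR : convergence R^o) (ell : convergence X)
    (mulX : X -> X -> X) (phi : X -> X)
    (psi : nat -> X -> X) (K : nat -> G -> G -> X -> X)
    (XXX : product_triple ell ell ell mulX)
    (RXX : product_triple ellR ell ell (fun (r : R) (x : X) => r *: x))
    (XRX : product_triple ell ellR ell (fun (x : X) (r : R) => r *: x))
    (Hstar : condition_Hstar ellR ell)
    (mu_sigma_finite : sigma_finite setT mu) (mu_regular : regular_measure mu)
    (phiP : modular_map mulX phi) (psiP : Xi psi)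
    (KP : K_class mu ellR ell psi K) :
  ((exists L H, M_singular mu ellR ell psi K L H) ->
    (exists alpha : R, 0 < alpha /\
      forall f : G -> X, Cc f -> operator_dom mu ellR ell K f ->
      forall A : set (borel G), fin_measurable mu A ->
        cv_in_measure mu ellR ell
          (fun n s => phi (alpha *: vabs (operator mu ellR ell K n f s - f s)))
          (fun=> 0) A) /\
    (forall f : G -> X, Cc f -> operator_dom mu ellR ell K f ->
      forall A : set (borel G), fin_measurable mu A ->
        cv_in_measure mu ellR ell (fun n => operator mu ellR ell K n f) f A)) /\
  (forall L H, U_singular mu ellR ell psi K L H ->
    (exists alpha : R, 0 < alpha /\
      forall f : G -> X, Cc f -> operator_dom mu ellR ell K f ->
      forall A : set (borel G), fin_measurable mu A ->
        cv_uniform_along ell H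
          (fun n s => phi (alpha *: vabs (operator mu ellR ell K n f s - f s)))
          (fun=> 0) A) /\
    (forall f : G -> X, Cc f -> operator_dom mu ellR ell K f ->
      forall A : set (borel G), fin_measurable mu A ->
        cv_uniform_along ell H
          (fun n => operator mu ellR ell K n f) f A)).
Proof.
(* The constant is [alpha = 1] in both cases; by monotonicity of [phi] a bound [x n] on the
   difference becomes a bound [phi (x n)] on its modular. *)
have phi_dom (x : nat -> X) (t : X) n : (forall n, 0 <= x n) -> 0 <= t ->
    t <= x n -> vabs (phi ((1 : R) *: t) - 0) <= phi (x n).
  move=> x0 t0 tx; rewrite scale1r subr0 ger0_vabs.
    exact: (phi_incr phiP t0 tx).
  by rewrite -(phi_0 phiP); exact: (phi_incr phiP (lexx 0) t0).
have phi_ge0 (x : nat -> X) n : (forall n, 0 <= x n) -> 0 <= phi (x n).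
  by move=> x0; rewrite -(phi_0 phiP); exact: (phi_incr phiP (lexx 0)).
split=> [[L [H MP]]|L H UP].
  have sing := M_sing MP.
  have M_dom f A : Cc f -> operator_dom mu ellR ell K f -> fin_measurable mu A ->
      exists (E : nat -> set (borel G)) (x : nat -> X),
      [/\ forall n, measurable (E n), cv_mu0 mu ellR E,
          [/\ forall n, 0 <= x n, cv ell x 0
            & exists2 u, 0 < u & forall n, x n <= u]
        & forall n s, H n -> (A `\` E n) s ->
            vabs (operator mu ellR ell K n f s - f s) <= x n].
    move=> Cf df fA; have [An [mAn An0 tails]] := M_tails MP fA.
    have [Dn [mDn Dn0 [z [eps [z0 eps0 oeps approx]]]]] := M_approx MP fA.
    (* Off the union of the two exceptional sets both the tail estimate and the approximation of the
       identity hold. *)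
    pose E n := An n `|` Dn n.
    have [|n s u Hn [As /not_orP[_ nDs]] u0|x [x0 xc xu xP]] :=
      @operator_dominated _ _ _ mu ellR ell RXX psi K L H (fun n => A `\` E n)
        z eps f psiP KP sing _ z0 eps0 oeps _ Cf df.
    - move=> delta /tails/cv_sup_dom[y [y0 yc yub]].
      exists y; split=> // n s [As /not_orP[nAs _]].
      by apply: yub; exists s.
    - have [ubF leF] := approx n Hn; apply: le_trans leF.
      by apply: le_supremum => //; exists u => //; exists s.
    - exists E, x; split=> //; first by move=> n; exact: measurableU.
      exact: cv_mu0U.
  have supR := sing_limsupR sing.
  split; last first.
    move=> f Cf df A fA; have [E [x [mE E0 [x0 xc _] xP]]] := M_dom _ _ Cf df fA.
    exact: cv_in_measure_along supR fA mE E0 x0 xc xP.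
  exists 1; split=> // f Cf df A fA.
  have [E [x [mE E0 [x0 xc [u u0 xu]] xP]]] := M_dom _ _ Cf df fA.
  (* The exceptional sets for [phi] are those of the operators; only the dominating sequence
     changes, from [x] to its image under [phi]. *)
  apply: (cv_in_measure_along supR fA mE E0 _
    (modular_map_cv0 XXX phiP u0 x0 xu xc)) => [n|n s Hn As].
    exact: phi_ge0.
  by apply: phi_dom => //; [exact: vabs_ge0|exact: xP].
have sing := U_sing UP.
have U_dom f A : Cc f -> operator_dom mu ellR ell K f -> fin_measurable mu A ->
    exists x : nat -> X, [/\ forall n, 0 <= x n, cv ell x 0,
      exists2 u, 0 < u & forall n, x n <= u
    & forall n s, H n -> A s ->
        vabs (operator mu ellR ell K n f s - f s) <= x n].
  move=> Cf df fA; have [z [eps [z0 eps0 oeps approx]]] := U_approx UP fA.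
  apply: (@operator_dominated _ _ _ mu ellR ell RXX psi K L H (fun=> A)
      z eps f psiP KP sing _ z0 eps0 oeps _ Cf df).
  - move=> delta delta0; have /cv_sup_dom[y [y0 yc yub]] := U_tails UP fA delta0.
    by exists y; split=> // n s As; apply: yub; exists s.
  - move=> n s u Hn As u0; have [ubF leF] := approx n Hn; apply: le_trans leF.
    by apply: le_supremum => //; exists u => //; exists s.
have supX := sing_limsup sing.
split; last first.
  move=> f Cf df A fA; have [x [x0 xc _ xP]] := U_dom _ _ Cf df fA.
  exact: cv_uniform_along_dom supX x0 xc xP.
exists 1; split=> // f Cf df A fA.
have [x [x0 xc [u u0 xu] xP]] := U_dom _ _ Cf df fA.
apply: (cv_uniform_along_dom supX _ (modular_map_cv0 XXX phiP u0 x0 xu xc)).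
  by move=> n; exact: phi_ge0.
by move=> n s Hn As; apply: phi_dom => //; [exact: vabs_ge0|exact: xP].
Qed.
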